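(* Let $k\in\mathbb N$, $r\in\mathbb N_0$, $1\le p\le\infty$, and let $\alpha,\beta\in\mathbb R$ satisfy $r/2+\alpha\ge0$ and $r/2+\beta\ge0$. If $f\in\mathbb B^{r}_p(w_{\alpha,\beta})$, then $$\omega_{k+1,r}^\varphi(f^{(r)},t)_{\alpha,\beta,p}\le c\,\omega_{k,r}^\varphi(f^{(r)},t)_{\alpha,\beta,p},\qquad t>0,$$ where $c$ depends only on $k,r,p,\alpha,\beta$.
   Context: Notation. $\mathbb N_0=\mathbb N\cup\{0\}$. For a measurable set $I\subseteq[-1,1]$ and measurable $f$, $\|f\|_{L_p(I)}=(\int_I|f|^p\,dx)^{1/p}$ for $p<\infty$ and $\|f\|_{L_\infty(I)}=\operatorname{ess\,sup}_{I}|f|$; $\|\cdot\|_p=\|\cdot\|_{L_p[-1,1]}$. For a weight $w$, $L_{w,p}=\{f:\|wf\|_p<\infty\}$. $\varphi(x)=\sqrt{1-x^2}$. $w_{\alpha,\beta}(x)=(1-x)^\alpha(1+x)^\beta$. Spaces: $\mathbb B^0_p(w)=L_{w,p}$ and, for $r\ge1$, $\mathbb B^r_p(w)=\{f: f^{(r-1)}\in AC_{loc}(-1,1)\text{ and }\varphi^rf^{(r)}\in L_{w,p}\}$, where $AC_{loc}(-1,1)$ is the set of functions locally absolutely continuous in $(-1,1)$. Differences: $\Delta_h^k(f,x)=\sum_{i=0}^k\binom ki(-1)^{k-i}f(x-\frac{kh}2+ih)$ if $[x-\frac{kh}2,x+\frac{kh}2]\subseteq[-1,1]$, and $\Delta_h^k(f,x)=0$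 otherwise. Weights and domains: $\mathcal W_\delta^{\xi,\zeta}(x)=(1-x-\delta\varphi(x)/2)^\xi(1+x-\delta\varphi(x)/2)^\zeta$; for $\delta>0$, $\mathfrak D_\delta=\{x: 1-\delta\varphi(x)/2\ge|x|\}\setminus\{\pm1\}=\{x:|x|\le\frac{4-\delta^2}{4+\delta^2}\}$ (empty if $\delta>2$). Modulus: for $k\in\mathbb N$, $r\in\mathbb N_0$ and $f\in\mathbb B^r_p(w_{\alpha,\beta})$, $$\omega_{k,r}^\varphi(f^{(r)},t)_{\alpha,\beta,p}=\sup_{0<h\le t}\big\|\mathcal W_{kh}^{r/2+\alpha,r/2+\beta}(\cdot)\,\Delta^k_{h\varphi(\cdot)}(f^{(r)},\cdot)\big\|_{L_p(\mathfrak D_{kh})}.$$ *)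

(* Defs.v *)
From HB Require Import structures.
From mathcomp Require Import all_boot all_order all_algebra.
From mathcomp Require Import all_classical all_reals all_analysis.

Set Implicit Arguments.
Unset Strict Implicit.
Unset Printing Implicit Defensive.

Import Order.TTheory GRing.Theory Num.Theory.
Import numFieldNormedType.Exports.

Local Open Scope classical_set_scope.
Local Open Scope ring_scope.

(* Functions on [-1, 1] are represented by total functions on R, whose values
   outside [-1, 1] are never used. *)

(* A copy of R whose sigma-algebra consists of the Lebesgue measurable sets (the
   canonical one on R is the Borel sigma-algebra). It is the carrier of
   [completed_lebesgue_measure]; see [completed_caratheodory_measurable]. *)
Definition lebesgueR (R : realType) : measurableType _ :=
  caratheodory_type ((@wlength R idfun)^*)%mu.

Definition I11 (R : realType) : set R := `[-1, 1].

Definition lebesgue_measurable_fun (R : realType) (D : set R) (f : R -> R) :=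
  @measurable_fun _ _ (lebesgueR R) R D f.

Definition Lp_norm (R : realType) (p : \bar R) (D : set R) (f : R -> R) : \bar R :=
  @Lnorm _ (lebesgueR R) R (@completed_lebesgue_measure R) p (EFin \o f \_ D).

Definition in_Lwp (R : realType) (w : R -> R) (p : \bar R) (f : R -> R) : Prop :=
  lebesgue_measurable_fun (@I11 R) f /\
  (Lp_norm p (@I11 R) (fun x => (w x * f x)%R) < +oo)%E.

Definition phi (R : realType) (x : R) : R := Num.sqrt (1 - x ^+ 2).

Definition jacobi (R : realType) (a b : R) (x : R) : R :=
  (1 - x) `^ a * (1 + x) `^ b.

Definition abs_continuous (R : realType) (a b : R) (f : R -> R) : Prop :=
  forall e : R, 0 < e -> exists2 d : R, 0 < d &
    forall (n : nat) (u v : 'I_n -> R),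
      (forall i, a <= u i /\ u i <= v i /\ v i <= b) ->
      trivIset setT (fun i => `]u i, v i[%classic) ->
      \sum_(i < n) (v i - u i) < d ->
      \sum_(i < n) `|f (v i) - f (u i)| < e.

Definition AC_loc (R : realType) (f : R -> R) : Prop :=
  forall a b : R, -1 < a -> a <= b -> b < 1 -> abs_continuous a b f.

(* [derive1n] is total, so the existence of the derivatives of order < r on
   (-1, 1) has to be required. The derivative of order r only exists almost
   everywhere; where it does not, [derive1n] has an irrelevant default value. *)
Definition in_B (R : realType) (w : R -> R) (p : \bar R) (r : nat) (f : R -> R) :
    Prop :=
  match r with
  | 0 => in_Lwp w p f
  | s.+1 =>
      [/\ forall j x, (j < s)%N -> -1 < x < 1 -> derivable (derive1n j f) x 1,
          AC_loc (derive1n s f)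
        & in_Lwp w p (fun x => phi x ^+ r * derive1n r f x)]
  end.

Definition sym_diff (R : realType) (k : nat) (h : R) (f : R -> R) (x : R) : R :=
  if `[< `[x - k%:R * h / 2, x + k%:R * h / 2] `<=` @I11 R >] then
    \sum_(i < k.+1) 'C(k, i)%:R * (-1) ^+ (k - i) *
      f (x - k%:R * h / 2 + i%:R * h)
  else 0.

Definition Wweight (R : realType) (delta xi zeta x : R) : R :=
  (1 - x - delta * phi x / 2) `^ xi * (1 + x - delta * phi x / 2) `^ zeta.

Definition Ddom (R : realType) (delta : R) : set R :=
  [set x | `|x| <= 1 - delta * phi x / 2] `\` [set -1; 1].

(* The weighted modulus of smoothness of g = f^(r). *)
Definition omega (R : realType) (k r : nat) (g : R -> R) (t alpha beta : R)
    (p : \bar R) : \bar R :=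
  ereal_sup [set Lp_norm p (Ddom (k%:R * h))
      (fun x => Wweight (k%:R * h) (r%:R / 2 + alpha) (r%:R / 2 + beta) x *
                sym_diff k (h * phi x) g x)
    | h in [set h : R | 0 < h <= t]].

(* Main.v *)
(** Write H = h phi(x). The difference of order k+1 at x with step H is a
  combination of differences of order k with step H/4 whose nodes stay in the
  interval J of radius (k+1)H/2 around x. On that finer scale Marchaud's
  identity [fwd_diff_marchaud] introduces a free parameter sigma: for every
  sigma in (0, 1/k) the difference of order k+1 at x is bounded by differences
  of order k with centers y = y(x, sigma) and steps eta = eta(x, sigma), whose
  supports lie in J, on which the weight is at least W_{(k+1)h}(x). Since
  eta <= H/2, the point (y, eta) satisfies eta = h' phi(y) with h' <= h.
  Averaging over sigma and changing variables from (x, sigma) to (y, h'), with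
  Jacobian bounded below by a multiple of h, turns the integral over x into an
  average over h' in (0, h] of the integrals controlled by omega_k. The change
  of variables is done one variable at a time, and only needs that a map psi
  with |psi u - psi v| >= c |u - v| satisfies
  mu (psi^-1 A) <= c^-1 mu A. *)
Require Import Defs.
From mathcomp Require Import all_boot all_order all_algebra.
From mathcomp Require Import all_classical all_reals all_analysis.
From mathcomp Require Import measurable_realfun ess_sup_inf.
From mathcomp Require Import ring lra zify.

Set Implicit Arguments.
Unset Strict Implicit.
Unset Printing Implicit Defensive.

Import Order.TTheory GRing.Theory Num.Theory.
Import numFieldNormedType.Exports.

Local Open Scope classical_set_scope.
Local Open Scope ring_scope.

(** * Finite differences *)

Section forward_difference.
Variable R : realType.
Implicit Types (g : R -> R) (b s : R).

Definition fwd_diff k g b s : R :=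
  \sum_(i < k.+1) 'C(k, i)%:R * (-1) ^+ (k - i) * g (b + i%:R * s).

Lemma fwd_diff0 g b s : fwd_diff 0 g b s = g b.
Proof. by rewrite /fwd_diff big_ord1 bin0 expr0 !mul1r mul0r addr0. Qed.

(** Pascal's rule for the binomial coefficients, once the first and last terms are split off. *)
Lemma fwd_diffS k g b s :
  fwd_diff k.+1 g b s = fwd_diff k g (b + s) s - fwd_diff k g b s.
Proof.
rewrite /fwd_diff big_ord_recl [X in _ = _ - X]big_ord_recl /=.
rewrite [X in _ + X]big_ord_recr [X in X - _]big_ord_recr /=.
rewrite !bin0 !binn !subn0 !mul1r !mul0r !addr0 /bump /= !add1n.
rewrite !subnn !expr0 !mul1r exprS.
under [X in _ + (X + _)]eq_bigr do rewrite /bump /= add1n subSS -[_.+1]/(bump 0 _).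
have -> : b + s + k%:R * s = b + k.+1%:R * s by rewrite mulrSr; ring.
have -> : \sum_(i < k) 'C(k.+1, bump 0 i)%:R * (-1) ^+ (k - i) *
            g (b + (bump 0 i)%:R * s) =
          \sum_(i < k) 'C(k, i)%:R * (-1) ^+ (k - i) * g (b + s + i%:R * s) -
          \sum_(i < k) 'C(k, bump 0 i)%:R * (-1) ^+ (k - bump 0 i) *
            g (b + (bump 0 i)%:R * s).
  rewrite -sumrB; apply: eq_bigr => i _; rewrite /bump /= add1n binS natrD.
  have -> : b + s + i%:R * s = b + i.+1%:R * s by rewrite mulrSr; ring.
  have -> : (k - i)%N = (k - i.+1).+1 by rewrite subnSK.
  by rewrite exprS; ring.
by ring.
Qed.

(** Lets an induction on the order peel off the innermost difference rather than the outermost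
    one. *)
Lemma fwd_diff_shift k g b s :
  fwd_diff k (fun x => g (x + s) - g x) b s = fwd_diff k.+1 g b s.
Proof.
elim: k b => [|k IH] b; first by rewrite fwd_diffS !fwd_diff0.
by rewrite fwd_diffS !IH [in RHS]fwd_diffS.
Qed.

Lemma fwd_diff_add k g1 g2 b s :
  fwd_diff k (fun x => g1 x + g2 x) b s = fwd_diff k g1 b s + fwd_diff k g2 b s.
Proof.
elim: k b => [|k IH] b; first by rewrite !fwd_diff0.
by rewrite !fwd_diffS !IH; ring.
Qed.

Lemma fwd_diff_transl k g b s c :
  fwd_diff k (fun x => g (x + c)) b s = fwd_diff k g (b + c) s.
Proof.
elim: k b => [|k IH] b; first by rewrite !fwd_diff0.
by rewrite !fwd_diffS !IH; congr (fwd_diff _ _ _ _ - _); ring.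
Qed.

(** A step to the left visits the same nodes from the other end; this later brings leftward
    differences to a positive step. *)
Lemma fwd_diff_rev k g b s :
  fwd_diff k g b (- s) = (-1) ^+ k * fwd_diff k g (b - k%:R * s) s.
Proof.
elim: k b => [|k IH] b; first by rewrite !fwd_diff0 mul0r subr0 mul1r.
rewrite !fwd_diffS !IH exprS mulrSr.
have -> : b - (k%:R + 1) * s + s = b - k%:R * s by ring.
have -> : b - s - k%:R * s = b - (k%:R + 1) * s by ring.
by ring.
Qed.

Lemma fwd_diff_step0 k g b : (0 < k)%N -> fwd_diff k g b 0 = 0.
Proof. by case: k => // k _; rewrite fwd_diffS addr0 subrr. Qed.

(** Here and below, only the larger of two terms is kept, so that a single difference remains, whose
    position may depend on [g]. *)
Lemma norm_fwd_diffS k g b s :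
  exists2 m, (m <= 1)%N &
    `|fwd_diff k.+1 g b s| <= 2 * `|fwd_diff k g (b + m%:R * s) s|.
Proof.
rewrite fwd_diffS.
have h := ler_normB (fwd_diff k g (b + s) s) (fwd_diff k g b s).
have [le|/ltW le] := leP `|fwd_diff k g b s| `|fwd_diff k g (b + s) s|.
  by exists 1%N => //; rewrite mul1r; lra.
by exists 0%N => //; rewrite mul0r addr0; lra.
Qed.

(** With [E] the translation by [s], [E^2 - 1 = (E + 1) (E - 1)]. The left side is thus a sum of
    [2 ^ k] translates of differences of step [s], one of which is selected factor by factor. *)
Lemma norm_fwd_diff_double k g b s :
  exists2 m, (m <= k)%N &
    `|fwd_diff k g b (2 * s)| <= 2 ^+ k * `|fwd_diff k g (b + m%:R * s) s|.
Proof.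
elim: k g b => [|k IH] g b.
  by exists 0%N => //; rewrite !fwd_diff0 expr0 mul1r mul0r addr0.
pose G x := g (x + s) - g x.
have -> : fwd_diff k.+1 g b (2 * s) =
    fwd_diff k G b (2 * s) + fwd_diff k G (b + s) (2 * s).
  rewrite -fwd_diff_shift -(fwd_diff_transl k G) -fwd_diff_add.
  congr fwd_diff; apply/funext => x; rewrite /G.
  have -> : x + s + s = x + 2 * s by ring.
  by ring.
have [m1 h1 e1] := IH G b; have [m2 h2 e2] := IH G (b + s).
rewrite fwd_diff_shift in e1; rewrite fwd_diff_shift in e2.
have e2' : b + s + m2%:R * s = b + m2.+1%:R * s by rewrite mulrSr; ring.
rewrite {}e2' in e2; rewrite exprS.
have h := ler_normD (fwd_diff k G b (2 * s)) (fwd_diff k G (b + s) (2 * s)).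
set A := fwd_diff k.+1 g _ s in e1; set B := fwd_diff k.+1 g _ s in e2.
have p2 : 0 < 2 ^+ k :> R by rewrite exprn_gt0.
have [le|/ltW le] := leP `|A| `|B|.
  by exists m2.+1 => //; rewrite -/B; have := ler_wpM2l (ltW p2) le; lra.
by exists m1; [exact: leqW|rewrite -/A; have := ler_wpM2l (ltW p2) le; lra].
Qed.

(** One lowering of the order and two halvings of the step produce the offset [4 m1 + 2 m2 + m3].
    The last node has offset at most [m + k <= 4 k + 4], so no node leaves the span [4 (k + 1) s] of
    the original difference. *)
Lemma fwd_diff_quarter k g b s :
  exists2 m, (m <= 3 * k + 4)%N &
    `|fwd_diff k.+1 g b (4 * s)| <=
      2 * 4 ^+ k * `|fwd_diff k g (b + m%:R * s) s|.
Proof.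
have [m1 h1 e1] := norm_fwd_diffS k g b (4 * s).
have [m2 h2] := norm_fwd_diff_double k g (b + m1%:R * (4 * s)) (2 * s).
have -> : 2 * (2 * s) = 4 * s by ring.
move=> e2.
have [m3 h3 e3] := norm_fwd_diff_double k g
  (b + m1%:R * (4 * s) + m2%:R * (2 * s)) s.
exists (4 * m1 + 2 * m2 + m3)%N; first by lia.
have <- : b + m1%:R * (4 * s) + m2%:R * (2 * s) + m3%:R * s =
  b + (4 * m1 + 2 * m2 + m3)%:R * s by ring.
have -> : 4 ^+ k = 2 ^+ k * 2 ^+ k :> R by rewrite -exprMn -natrM.
have p2 : 0 <= 2 ^+ k :> R by rewrite exprn_ge0.
by have := ler_wpM2l p2 e3; lra.
Qed.

(* Both sides are the double sum of the signed values g (b + j h + l j s). *)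
Lemma fwd_diff_marchaud k g b h s :
  \sum_(l < k.+1) 'C(k, l)%:R * (-1) ^+ (k - l) * fwd_diff k g b (h + l%:R * s) =
  \sum_(j < k.+1) 'C(k, j)%:R * (-1) ^+ (k - j) *
    fwd_diff k g (b + j%:R * h) (j%:R * s).
Proof.
rewrite /fwd_diff.
under eq_bigr do rewrite mulr_sumr.
rewrite exchange_big /=; apply: eq_bigr => j _; rewrite mulr_sumr.
apply: eq_bigr => l _.
have -> : b + j%:R * (h + l%:R * s) = b + j%:R * h + l%:R * (j%:R * s) by ring.
by ring.
Qed.

Lemma sum_le_some_term n (a : 'I_n -> R) : (0 < n)%N ->
  exists i, \sum_(j < n) a j <= n%:R * a i.
Proof.
move=> n0; apply/not_existsP => H.
have : \sum_(i < n) n%:R * a i < \sum_(i < n) \sum_(j < n) a j.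
  apply: ltr_sum => [|i _]; last by rewrite real_ltNge ?num_real//; apply/negP/H.
  by apply/hasP; exists (Ordinal n0) => //; rewrite mem_index_enum.
by rewrite -mulr_sumr sumr_const card_ord -[X in _ < X]mulr_natl ltxx.
Qed.

(** Marchaud's identity solved for its term [l = 0] on the left. The term [j = 0] on the right has
    step 0 and vanishes; the [2 k] remaining terms have coefficients at most [2 ^ k]. *)
Lemma norm_fwd_diff_marchaud k g b h s : (0 < k)%N ->
  exists l : 'I_k,
    `|fwd_diff k g b h| <= 2 * k%:R * 2 ^+ k *
       `|fwd_diff k g b (h + l.+1%:R * s)| \/
    `|fwd_diff k g b h| <= 2 * k%:R * 2 ^+ k *
       `|fwd_diff k g (b + l.+1%:R * h) (l.+1%:R * s)|.
Proof.
move=> k0; have := fwd_diff_marchaud k g b h s.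
rewrite big_ord_recl [in RHS]big_ord_recl /= !bin0 !mul0r !addr0 !subn0.
rewrite fwd_diff_step0// mulr0 add0r mul1r => E.
pose A (l : 'I_k) := fwd_diff k g b (h + l.+1%:R * s).
pose B (l : 'I_k) := fwd_diff k g (b + l.+1%:R * h) (l.+1%:R * s).
pose c (l : 'I_k) : R := 'C(k, l.+1)%:R * (-1) ^+ (k - l.+1).
have {E}-> : `|fwd_diff k g b h| = `|\sum_(l < k) (c l * B l - c l * A l)|.
  rewrite sumrB; have -> : \sum_(l < k) c l * B l - \sum_(l < k) c l * A l =
      (-1) ^+ k * fwd_diff k g b h by rewrite -[X in X - _]E addrK.
  by rewrite normrM normrX normrN1 expr1n mul1r.
have cle l : `|c l| <= 2 ^+ k.
  rewrite normrM normrX normrN1 expr1n mulr1 normr_nat -natrX ler_nat.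
  have : (\sum_(i < k.+1) 'C(k, i) = 2 ^ k)%N.
    by rewrite -[2%N]/(1 + 1)%N expnDn; apply: eq_bigr => i _; rewrite !exp1n !muln1.
  by move=> <-; rewrite (bigD1 (lift ord0 l))//= leq_addr.
have [l Hl] := sum_le_some_term (fun l => `|c l * B l - c l * A l|) k0.
have {Hl} H := le_trans (ler_norm_sum _ _ _) Hl.
have {}H : `|\sum_(l < k) (c l * B l - c l * A l)| <=
    k%:R * (2 ^+ k * (`|B l| + `|A l|)).
  apply: (le_trans H); rewrite ler_wpM2l//.
  rewrite -mulrBr normrM ler_pM// ?ler_normB//.
have pk : 0 <= k%:R * 2 ^+ k :> R by rewrite mulr_ge0// exprn_ge0.
exists l; have [le|/ltW le] := leP `|A l| `|B l|; [right|left].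
  by rewrite -/(B l); have := ler_wpM2l pk le; lra.
by rewrite -/(A l); have := ler_wpM2l pk le; lra.
Qed.

End forward_difference.

(** * Position of the fine differences inside the interval J *)

Section nodes.
Variables (R : realType) (k : nat).
Hypothesis k0 : (0 < k)%N.

Definition central_diff (g : R -> R) (y s : R) := fwd_diff k g (y - k%:R * s / 2) s.

(* In (m, b, l), m numbers the differences of step H/4 supported in J, and l + 1
   is the index of a term of Marchaud's identity, on its left-hand side if b and
   on its right-hand side otherwise. The identity is applied leftwards or
   rightwards depending on m, so as to stay in J. [node_base] and [node_step] are
   in units of H, the former relative to x. *)
Definition node_index := ('I_(3 * k + 5) * bool * 'I_k)%type.
Implicit Types t : node_index.

Definition node_sign t : R := if (k + 2 <= t.1.1)%N then -1 else 1.

Definition node_base t : R :=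
  (if (k + 2 <= t.1.1)%N then (t.1.1 + k)%:R else t.1.1%:R) / 4 - k.+1%:R / 2 +
  (if t.1.2 then 0 else node_sign t * t.2.+1%:R / 4).

(** The rate of [node_step] in sigma; its lower bound 1/4 makes the passage from sigma to the step
    expanding. *)
Definition node_slope t : R := t.2.+1%:R / 4.

Definition node_step t (sigma : R) : R :=
  (if t.1.2 then 4^-1 else 0) + node_slope t * sigma.

Definition node_center t (x H sigma : R) : R :=
  x + node_base t * H + node_sign t * k%:R * (node_step t sigma * H) / 2.

(** The constant of [fwd_diff_quarter] times that of [norm_fwd_diff_marchaud]. *)
Definition node_const : R := 2 * 4 ^+ k * (2 * k%:R * 2 ^+ k).

Lemma node_const_gt0 : 0 < node_const.
Proof. by rewrite !mulr_gt0 ?exprn_gt0// ltr0n. Qed.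

Lemma node_slope_ge t : 4^-1 <= node_slope t.
Proof. by rewrite /node_slope ler_peMl ?invr_ge0// ler1n. Qed.

Lemma node_sign_cases t : node_sign t = 1 \/ node_sign t = -1.
Proof. by rewrite /node_sign; case: ifP; [right|left]. Qed.

Let notle (m : nat) : ~~ (k + 2 <= m)%N -> (m <= k.+1)%N. Proof. by lia. Qed.

(** The base is one end of the support of the difference. The same bound makes [node_map_expanding]
    applicable to the center during the averaging. *)
Lemma node_base_le t : `|node_base t| <= k.+1%:R / 2.
Proof.
have mk : (t.1.1 <= 3 * k + 4)%N by rewrite -ltnS -addnS.
rewrite ler_norml /node_base /node_sign; set L : R := t.2.+1%:R.
have L1 : 1 <= L by rewrite /L ler1n.
have Lk : L <= k%:R by rewrite /L ler_nat.
case: ifPn => h.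
  have {}h : (k%:R + 2 <= t.1.1%:R :> R) by rewrite -natrD ler_nat.
  have {}mk : (t.1.1%:R <= 3 * k%:R + 4 :> R) by rewrite -natrM -natrD ler_nat.
  rewrite natrD -natr1.
  by case: t.1.2; apply/andP; split; lra.
have {}h : (t.1.1%:R <= k%:R + 1 :> R) by rewrite natr1 ler_nat; exact: notle.
have m0 : (0 <= t.1.1%:R :> R) by [].
rewrite -natr1.
by case: t.1.2; apply/andP; split; lra.
Qed.

Section bounds.
Variables (t : node_index) (sigma : R).
Hypotheses (s0 : 0 < sigma) (s1 : sigma < k%:R^-1).

Let kR0 : 0 < k%:R :> R. Proof. by rewrite ltr0n. Qed.
Let L : R := t.2.+1%:R.
Let L1 : 1 <= L. Proof. by rewrite /L ler1n. Qed.
Let Lk : L <= k%:R. Proof. by rewrite /L ler_nat. Qed.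
Let Ls1 : L * sigma < 1.
Proof.
apply: le_lt_trans (_ : k%:R * sigma < 1); first by rewrite ler_wpM2r// ltW.
by rewrite mulrC -ltr_pdivlMr// mul1r.
Qed.
Let Ls0 : 0 < L * sigma. Proof. by rewrite mulr_gt0// (lt_le_trans _ L1). Qed.

Lemma node_step_gt0 : 0 < node_step t sigma.
Proof.
rewrite /node_step /node_slope -/L; have := Ls0.
by case: t.1.2; lra.
Qed.

(** Both summands are at most 1/4, the second because [l + 1 <= k] and [sigma < 1 / k]. The bound
    1/2 is what [subinterval_step_le] asks for. *)
Lemma node_step_le : node_step t sigma <= 2^-1.
Proof.
rewrite /node_step /node_slope -/L; have := Ls1.
by case: t.1.2; lra.
Qed.

Let kstep : k%:R * node_step t sigma <=
  k%:R / 4 + (if t.1.2 then k%:R / 4 else 0).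
Proof.
rewrite /node_step /node_slope -/L.
have h : k%:R * (L * sigma) <= k%:R by rewrite ger_pMr// ltW.
by case: t.1.2; lra.
Qed.

(** In units of H/4, J runs from 0 to [4 k + 4], and the far end is at most [2 k] away from the
    starting node. Rightwards it is at most [m + 2 k <= 3 k + 1]; leftwards it is at least
    [(m + k) - 2 k >= 2]. This is why the direction changes at [m = k + 2]. *)
Lemma node_end_le :
  `|node_base t + node_sign t * k%:R * node_step t sigma| <= k.+1%:R / 2.
Proof.
have mk : (t.1.1 <= 3 * k + 4)%N by rewrite -ltnS -addnS.
have kge := kstep; have kgt : 0 < k%:R * node_step t sigma.
  by rewrite mulr_gt0// node_step_gt0.
rewrite ler_norml /node_base /node_sign -/L -[_ * _ * node_step _ _]mulrA.
set w := k%:R * node_step t sigma in kge kgt *.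
case: ifPn => h.
  have {}h : (k%:R + 2 <= t.1.1%:R :> R) by rewrite -natrD ler_nat.
  have {}mk : (t.1.1%:R <= 3 * k%:R + 4 :> R) by rewrite -natrM -natrD ler_nat.
  rewrite natrD -natr1; move: L1 Lk => ? ?; move: kge.
  by case: t.1.2 => ?; apply/andP; split; lra.
have {}h : (t.1.1%:R <= k%:R + 1 :> R) by rewrite natr1 ler_nat; exact: notle.
have m0 : (0 <= t.1.1%:R :> R) by [].
rewrite -natr1; move: L1 Lk => ? ?; move: kge.
by case: t.1.2 => ?; apply/andP; split; lra.
Qed.

End bounds.

Lemma norm_central_diffS g x H sigma : exists t : node_index,
  `|fwd_diff k.+1 g (x - k.+1%:R * H / 2) H| <=
  node_const * `|central_diff g (node_center t x H sigma) (node_step t sigma * H)|.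
Proof.
pose h := H / 4; have HE : H = 4 * h by rewrite /h; field.
have [m mk] := fwd_diff_quarter k g (x - k.+1%:R * H / 2) h.
rewrite -HE; set b := _ + m%:R * h => e1.
have lm : (m < 3 * k + 5)%N by rewrite addnS ltnS.
(* Start from the left node and go right, or from the right node and go left, whichever leaves room
   for the longer steps of Marchaud's identity. *)
pose sg : R := if (k + 2 <= m)%N then -1 else 1.
pose c := if (k + 2 <= m)%N then b + k%:R * h else b.
have {}e1 : `|fwd_diff k.+1 g (x - k.+1%:R * H / 2) H| <=
    2 * 4 ^+ k * `|fwd_diff k g c (sg * h)|.
  apply: (le_trans e1); rewrite /c /sg; case: ifP => _; last by rewrite mul1r.
  by rewrite mulN1r fwd_diff_rev addrK normrM normrX normrN1 expr1n mul1r.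
have [l Hl] := norm_fwd_diff_marchaud g c (sg * h) (sg * sigma * h) k0.
have p4 : 0 <= 2 * 4 ^+ k :> R by rewrite mulr_ge0// exprn_ge0.
(* In either direction the norm is that of a central difference of step [s]. *)
have key (d s : R) : `|fwd_diff k g d (sg * s)| =
    `|central_diff g (d + sg * k%:R * s / 2) s|.
  rewrite /central_diff /sg; case: ifP => _.
    rewrite mulN1r fwd_diff_rev normrM normrX normrN1 expr1n mul1r.
    by congr (`|fwd_diff _ _ _ _|); field.
  by rewrite mul1r; congr (`|fwd_diff _ _ _ _|); field.
have baseE : (if (k + 2 <= m)%N then (m + k)%:R else m%:R) / 4 * H -
    k.+1%:R / 2 * H + x = c.
  by rewrite /c /b /h; case: ifP => _; rewrite ?natrD; field.
case: Hl => Hl; [exists (Ordinal lm, true, l)|exists (Ordinal lm, false, l)];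
  apply: (le_trans e1); rewrite /node_const -[leRHS]mulrA ler_wpM2l//;
  apply: (le_trans Hl); rewrite le_eqVlt; apply/orP; left; apply/eqP;
  congr (_ * _).
- have -> : sg * h + l.+1%:R * (sg * sigma * h) =
      sg * (h + l.+1%:R * sigma * h) by ring.
  rewrite key; congr (`|central_diff _ _ _|).
    rewrite /node_center /node_base /node_sign /node_step /node_slope /= -/sg.
    by rewrite -baseE /h; set u := (if _ then _ else _); field.
  by rewrite /node_step /node_slope /= /h; field.
- have -> : l.+1%:R * (sg * sigma * h) = sg * (l.+1%:R * sigma * h) by ring.
  rewrite key; congr (`|central_diff _ _ _|).
    rewrite /node_center /node_base /node_sign /node_step /node_slope /= -/sg.
    by rewrite -baseE /h; set u := (if _ then _ else _); field.
  by rewrite /node_step /node_slope /= /h; field.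
Qed.

(** An interval lies in J as soon as its two ends do, and these are controlled by [node_base_le] and
    [node_end_le]. *)
Lemma node_subinterval t x H sigma : 0 <= H -> 0 < sigma -> sigma < k%:R^-1 ->
  `|node_center t x H sigma - x| + k%:R * (node_step t sigma * H) / 2 <=
  k.+1%:R * H / 2.
Proof.
move=> H0 s0 s1.
have -> : node_center t x H sigma - x =
    (node_base t + node_sign t * k%:R * node_step t sigma / 2) * H.
  by rewrite /node_center; field.
rewrite normrM (ger0_norm H0).
have bl := node_base_le t; have el := node_end_le t s0 s1.
suff : `|node_base t + node_sign t * k%:R * node_step t sigma / 2| +
    k%:R * node_step t sigma / 2 <= k.+1%:R / 2.
  by move/(ler_wpM2r H0); congr (_ <= _); field.
rewrite ler_norml in bl; rewrite ler_norml in el.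
rewrite -lerBrDr ler_norml; case: (node_sign_cases t) => sE;
  rewrite sE in el *; move/andP: bl => [? ?]; move/andP: el => [? ?];
  apply/andP; split; lra.
Qed.

End nodes.

(** * Geometry of phi *)

Section phi_geometry.
Variable R : realType.
Implicit Types x y h s d : R.

Lemma phi_ge0 x : 0 <= phi x. Proof. exact: sqrtr_ge0. Qed.

Lemma sqr_phi x : `|x| <= 1 -> phi x ^+ 2 = 1 - x ^+ 2.
Proof.
by move=> x1; rewrite sqr_sqrtr// subr_ge0 -real_normK ?num_real// expr_le1.
Qed.

Lemma phi_gt0 x : `|x| < 1 -> 0 < phi x.
Proof.
by move=> x1; rewrite sqrtr_gt0 subr_gt0 -real_normK ?num_real// expr_lt1.
Qed.

Lemma Ddom_norm_lt1 d x : 0 <= d -> Ddom d x -> `|x| < 1.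
Proof.
move=> d0 [/= xd /not_orP[xN1 x1]]; rewrite lt_neqAle; apply/andP; split.
  rewrite eqr_norml negb_and negb_or ler01 orbF; apply/andP; split; exact/eqP.
by rewrite (le_trans xd)// gerBl divr_ge0// mulr_ge0// phi_ge0.
Qed.

Lemma DdomP d x : 0 <= d -> Ddom d x <-> `|x| < 1 /\ `|x| <= 1 - d * phi x / 2.
Proof.
move=> d0; split => [xD|[x1 xd]]; first by split; [exact: Ddom_norm_lt1 xD|case: xD].
split => //= -[] xE; move: x1; rewrite xE ?normrN normr1 ltxx//.
Qed.

(** The slope of [a phi] is [- a z / phi z]. On [Ddom d], [|a| phi z <= 1 - |z|], so the slope is at
    most [|z| (1 - |z|) / phi z ^ 2 = |z| / (1 + |z|) <= 1/2] in absolute value. *)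
Lemma phi_quasi_lipschitz d x y a :
  0 <= d -> Ddom d x -> Ddom d y -> `|a| <= d / 2 ->
  `|a * (phi x - phi y)| <= `|x - y| / 2.
Proof.
move=> d0 xD yD ad.
(* The slope bound, cleared of its denominator. *)
have B z : Ddom d z -> `|a * z| <= phi z / 2.
  move=> zD; have [z1 zd] := (DdomP _ d0).1 zD; have p0 := phi_gt0 z1.
  rewrite normrM -(ler_pM2r p0).
  have h1 : `|a| * phi z <= 1 - `|z|.
    have := ler_wpM2r (ltW p0) ad; lra.
  have h2 : phi z * phi z = (1 - `|z|) * (1 + `|z|).
    by rewrite -expr2 sqr_phi ?ltW// -real_normK ?num_real//; ring.
  have z0 := normr_ge0 z.
  have h3 := ler_wpM2l z0 h1.
  have h4 : `|z| * (1 - `|z|) <= (1 + `|z|) / 2 * (1 - `|z|).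
    by apply: ler_wpM2r; lra.
  lra.
have [x1 y1] := (Ddom_norm_lt1 d0 xD, Ddom_norm_lt1 d0 yD).
have p0 : 0 < phi x + phi y by rewrite addr_gt0// phi_gt0.
(* Multiplying by [phi x + phi y] turns the difference of square roots into a difference of squares,
   which is polynomial. *)
rewrite -(ler_pM2r p0) -{1}(gtr0_norm p0) -normrM.
have -> : a * (phi x - phi y) * (phi x + phi y) = (a * x + a * y) * (y - x).
  have -> : a * (phi x - phi y) * (phi x + phi y) = a * (phi x ^+ 2 - phi y ^+ 2).
    by ring.
  by rewrite !sqr_phi ?ltW//; ring.
rewrite normrM (distrC y).
have h : `|a * x + a * y| <= (phi x + phi y) / 2.
  by apply: le_trans (ler_normD _ _) _; have := B _ xD; have := B _ yD; lra.
by have := ler_wpM2r (normr_ge0 (x - y)) h; lra.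
Qed.

(** A perturbation of the identity with Lipschitz constant 1/2 contracts distances at most by
    half. *)
Lemma node_map_expanding d a x y : 0 <= d -> `|a| <= d / 2 -> Ddom d x -> Ddom d y ->
  2^-1 * `|x - y| <= `|(x + a * phi x) - (y + a * phi y)|.
Proof.
move=> d0 ad xD yD; have h := phi_quasi_lipschitz d0 xD yD ad.
have -> : x + a * phi x - (y + a * phi y) = (x - y) + a * (phi x - phi y) by ring.
by have := lerB_normD (x - y) (a * (phi x - phi y)); lra.
Qed.

Section subinterval.
Variables (k : nat) (h x y s : R).
Hypotheses (k0 : (0 < k)%N) (h0 : 0 < h) (xD : Ddom (k.+1%:R * h) x).
Hypotheses (s0 : 0 < s) (sx : s <= h * phi x / 2).
Hypothesis yx : `|y - x| + k%:R * s / 2 <= k.+1%:R * (h * phi x) / 2.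

Let kh0 : 0 <= k.+1%:R * h. Proof. by rewrite mulr_ge0// ltW. Qed.
Let x1 : `|x| < 1. Proof. exact: Ddom_norm_lt1 xD. Qed.
Let xd : `|x| <= 1 - k.+1%:R * (h * phi x) / 2.
Proof. by have [_] := (DdomP _ kh0).1 xD; rewrite -!mulrA. Qed.

Lemma subinterval_norm_le : `|y| <= 1 - k%:R * s / 2.
Proof.
have -> : y = (y - x) + x by ring.
by have := ler_normD (y - x) x; have := xd; have := yx; lra.
Qed.

Let ks0 : 0 < k%:R * s. Proof. by rewrite mulr_gt0// ltr0n. Qed.
Let y1 : `|y| < 1. Proof. by have := subinterval_norm_le; have := ks0; lra. Qed.

(** [1 - e y] is the distance from [y] to the endpoint [e], and [|y - x|] is at most the radius of
    J, hence at most [1 - e x]. *)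
Let one_sided (e : R) : `|e| = 1 -> (1 - e * y <= 2 * (1 - e * x)).
Proof.
move=> e1; have h1 : e * (x - y) <= `|y - x|.
  by rewrite (le_trans (ler_norm _))// normrM e1 mul1r distrC.
have h2 : e * x <= `|x| by rewrite (le_trans (ler_norm _))// normrM e1 mul1r.
by have := xd; have := yx; have := ks0; lra.
Qed.

Lemma subinterval_phi_le : phi y <= 2 * phi x.
Proof.
rewrite -ler_sqr ?nnegrE ?mulr_ge0 ?phi_ge0// exprMn !sqr_phi ?(ltW x1) ?(ltW y1)//.
have h1 := one_sided (normr1 _); have := one_sided (normrN1 _).
rewrite !mulN1r !opprK => h2; rewrite !mul1r in h1.
have h3 : 0 <= 1 - y /\ 0 <= 1 + y.
  by move: y1; rewrite ltr_norml => /andP[? ?]; split; lra.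
have := ler_pM h3.1 h3.2 h1 h2; lra.
Qed.

(** The distance from [y] to [e] is at least [A - q + k s / 2], and [k s / 2 >= T q / 2] because
    [q <= k H]. Since [q <= A], this is at least [T A / 2], which dominates [T ^ 2 A] as
    [T <= 1/2]. *)
Let toward (e : R) : `|e| = 1 -> 0 <= e * (y - x) ->
  (s / (h * phi x)) ^+ 2 * (1 - e * x) <= 1 - e * y.
Proof.
move=> e1 eyx; set H := h * phi x; have H0 : 0 < H by rewrite mulr_gt0// phi_gt0.
set T := s / H; have sT : s = T * H by rewrite /T divfK// gt_eqF.
have T0 : 0 < T by rewrite divr_gt0.
have T1 : T <= 2^-1 by rewrite /T ler_pdivrMr// mulrC.
have h1 : e * (y - x) <= `|y - x|.
  by rewrite (le_trans (ler_norm _))// normrM e1 mul1r.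
have h2 : e * x <= `|x| by rewrite (le_trans (ler_norm _))// normrM e1 mul1r.
set q := k.+1%:R * H / 2.
have kH : q <= k%:R * H.
  have k1 : 1 * H <= k%:R * H by rewrite ler_wpM2r ?ler1n// ltW.
  by rewrite /q -natr1; lra.
have h3 := ler_wpM2l (ltW T0) kH.
have xq : `|x| <= 1 - q := xd.
have yq : `|y - x| + k%:R * s / 2 <= q := yx.
set A := 1 - e * x; have Aq : q <= A by rewrite /A; lra.
have Ay : A - q + T * q / 2 <= 1 - e * y by rewrite /A; move: yq; rewrite sT; lra.
apply: le_trans Ay.
have h4 : 0 <= (A - q) * (1 - T / 2) by rewrite mulr_ge0//; lra.
have q0 : 0 < q by rewrite /q divr_gt0// mulr_gt0.
have h5 : T ^+ 2 * A <= T / 2 * A.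
  by rewrite ler_wpM2r// ?expr2; [lra|rewrite ler_wpM2l// ltW].
lra.
Qed.

(** After squaring, [phi] factors into the distances to the two endpoints. The factor [T ^ 2] is
    spent on the endpoint that [y] approaches, by [toward]; the other distance does not decrease. *)
Lemma subinterval_step_le : s <= h * phi y.
Proof.
have px := phi_gt0 x1; have py := phi_gt0 y1.
set T := s / (h * phi x).
have T0 : 0 <= T by rewrite divr_ge0 ?ltW// mulr_gt0.
have sT : s = h * (T * phi x) by rewrite /T; field; rewrite !gt_eqF.
rewrite [leLHS]sT ler_pM2l// -ler_sqr ?nnegrE ?phi_ge0 ?(mulr_ge0 T0 (phi_ge0 x))//.
rewrite exprMn !sqr_phi ?(ltW x1) ?(ltW y1)//.
have F (z : R) : 1 - z ^+ 2 = (1 - z) * (1 + z) by ring.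
rewrite !F; have [x2 x3] : 0 <= 1 - x /\ 0 <= 1 + x.
  by move: x1; rewrite ltr_norml => /andP[? ?]; split; lra.
have T2 : 0 <= T ^+ 2 by rewrite exprn_ge0.
have [yx0|yx0] := lerP x y.
  have := toward (normr1 _); rewrite !mul1r subr_ge0 => /(_ yx0) h1.
  have h2 : T ^+ 2 * (1 - x) * (1 + x) <= (1 - y) * (1 + y).
    by apply: ler_pM => //; [exact: mulr_ge0|lra].
  by rewrite -mulrA in h2.
have := toward (normrN1 _); rewrite !mulN1r opprB subr_ge0 !opprK.
move=> /(_ (ltW yx0)) h1.
have h2 : (1 - x) * (T ^+ 2 * (1 + x)) <= (1 - y) * (1 + y).
  by apply: ler_pM => //; [exact: mulr_ge0|lra].
by rewrite mulrCA in h2.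
Qed.

End subinterval.
End phi_geometry.

(** * Expanding maps *)

Section expanding.
Variable R : realType.
Local Open Scope ereal_scope.
Notation mu := (@lebesgue_measure R).

(* On arbitrary sets, [lebesgue_measure] is the outer measure. *)
Let mu_outer (F : (set R)^nat) : mu (\bigcup_n F n) <= \sum_(i <oo) mu (F i).
Proof. exact: (outer_measure_sigma_subadditive ((@wlength R idfun)^*)%mu). Qed.

Let le_mu (A B : set R) : A `<=` B -> mu A <= mu B.
Proof. exact: (le_outer_measure ((@wlength R idfun)^*)%mu). Qed.

(** Such a set lies in the interval from [inf S] to [inf S + d]. *)
Lemma diameter_le_measure (S : set R) (d : R) : (0 <= d)%R ->
  (forall u v, S u -> S v -> (`|u - v| <= d)%R) -> mu S <= d%:E.
Proof.
move=> d0 Sd; have [->|/set0P[w Sw]] := eqVneq S set0; first by rewrite measure0.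
have hS : has_inf S.
  split; first by exists w.
  exists (w - d)%R => v Sv; have := Sd _ _ Sw Sv; rewrite ler_norml => /andP[_].
  by rewrite lerBlDr addrC -lerBlDr.
have SI : S `<=` `[inf S, (inf S + d)%R].
  move=> v Sv /=; rewrite in_itv /=; apply/andP; split.
    by apply: ge_inf => //; case: hS.
  rewrite -lerBlDr; apply: lb_le_inf; first by case: hS.
  move=> u Su; have := Sd _ _ Sv Su; rewrite ler_norml => /andP[_].
  by rewrite lerBlDr addrC -lerBlDr.
apply: le_trans (le_mu SI) _; rewrite lebesgue_measure_itv /= lte_fin.
by case: ifP => _; [rewrite -EFinB lee_fin; lra|rewrite lee_fin].
Qed.

Variables (E : set R) (psi : R -> R) (c : R).
Hypothesis c0 : (0 < c)%R.
Hypothesis psiE : forall u v, E u -> E v -> (c * `|u - v| <= `|psi u - psi v|)%R.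

(** Cover [A] by intervals: the part of [E] sent into an interval has diameter at most [c^-1] times
    its length. Outer measures are compared, so [A] may be any set. *)
Lemma measure_expanding_preimage (A : set R) :
  mu (E `&` psi @^-1` A) <= c^-1%:E * mu A.
Proof.
rewrite [X in _ <= _ * X]/lebesgue_measure /= /lebesgue_stieltjes_measure /=.
rewrite /measure_extension /= lee_pdivlMl//.
apply: le_ereal_inf_tmp => _ [F [mF AF] <-].
rewrite -lee_pdivlMl//.
have F0 n : 0 <= wlength idfun (F n) by exact: wlength_ge0.
rewrite -nneseriesZl; last by move=> n _; exact: F0.
have sub : E `&` psi @^-1` A `<=` \bigcup_n (E `&` psi @^-1` (F n)).
  by move=> x [Ex /AF[n _ Fn]]; exists n.
apply: le_trans (le_mu sub) _; apply: le_trans (mu_outer _) _.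
apply: lee_nneseries => [n _ _|n _]; first exact: measure_ge0.
have [[a b] /= _ <-] := mF n.
rewrite wlength_itv /= lte_fin; case: ifPn => ab.
  rewrite -EFinB -EFinM; apply: diameter_le_measure => [|u v].
    by rewrite mulr_ge0 ?invr_ge0 ?subr_ge0 ?(ltW c0) ?(ltW ab).
  move=> [Eu /=]; rewrite in_itv /= => /andP[u1 u2] [Ev /=].
  rewrite in_itv /= => /andP[v1 v2].
  rewrite -ler_pdivrMl ?invr_gt0// invrK (le_trans (psiE Eu Ev))//.
  by rewrite ler_norml; apply/andP; split; lra.
rewrite set_itv_ge ?bnd_simp//.
by rewrite preimage_set0 setI0 measure0 mule0.
Qed.

Lemma measure_expanding_preimage0 (A : set R) :
  mu A = 0 -> mu (E `&` psi @^-1` A) = 0.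
Proof.
move=> A0; apply/eqP; rewrite eq_le measure_ge0 andbT.
by rewrite (le_trans (measure_expanding_preimage A))// A0 mule0.
Qed.

Hypotheses (mE : measurable E) (mpsi : measurable_fun [set: R] psi).

(** The pushforward by [psi] of the measure restricted to [E] is dominated by [c^-1 mu]. *)
Lemma integral_expanding_le (f : R -> \bar R) :
  measurable_fun [set: R] f -> (forall x, 0 <= f x) ->
  \int[mu]_(x in E) f (psi x) <= c^-1%:E * \int[mu]_x f x.
Proof.
move=> mf f0.

pose nu0 : {measure set (measurableTypeR R) -> \bar R} :=
  pushforward (mrestr mu mE) (psi : measurableTypeR R -> measurableTypeR R).
pose nu := nu0 mpsi.
have c1 : (0 <= c^-1)%R by rewrite invr_ge0 ltW.
have mfpsi : measurable_fun setT (f \o psi) by exact: measurableT_comp.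
apply: (@le_trans _ _ (\int[nu]_x f x)).
  rewrite ge0_integral_pushforward//= preimage_setT.
  rewrite [leLHS](_ : _ = \int[mrestr mu mE]_(x in E) f (psi x)).
    exact: ge0_subset_integral.
  by apply: eq_measure_integral => A mA AE; rewrite /= /mrestr setIidl.
rewrite -(@ge0_integral_mscale _ _ _ mu setT measurableT (NngNum c1) f)//.
pose nu2 : {measure set (measurableTypeR R) -> \bar R} := mscale (NngNum c1) mu.
apply: (@ge0_le_measure_integral _ _ _ nu nu2) => // S mS.
have -> : nu S = mu (E `&` psi @^-1` S) by rewrite setIC.
exact: measure_expanding_preimage.
Qed.

End expanding.

(** * Measurability of phi and of the domains *)

Section measurability.
Variable R : realType.

Lemma measurable_phi : measurable_fun [set: R] (@phi R).
Proof.
apply: continuous_measurable_fun => x; rewrite /phi.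
apply: (@continuous_comp _ _ _ (fun x : R => 1 - x ^+ 2) Num.sqrt).
  by apply: cvgB; [exact: cvg_cst|exact: exprn_continuous].
exact: sqrt_continuous.
Qed.

Lemma measurable_phi_comp d (T : measurableType d) (D : set T) (f : T -> R) :
  measurable_fun D f -> measurable_fun D (fun x => phi (f x)).
Proof. by move=> mf; apply: (measurableT_comp measurable_phi). Qed.

Lemma measurable_Ddom (e : R) : 0 <= e -> measurable (Ddom e : set R).
Proof.
move=> e0; pose b (x : R) := (`|x| < 1) && (`|x| <= 1 - e * phi x / 2).
have mb : measurable_fun [set: R] b.
  apply: measurable_and; first exact: measurable_fun_ltr.
  apply: measurable_fun_ler => //; apply: measurable_funB => //.
  apply: measurable_funM => //; apply: measurable_funM => //.
  exact: measurable_phi.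
rewrite (_ : Ddom e = b @^-1` [set true]).
  by rewrite -[X in measurable X]setTI; exact: mb.
apply/seteqP; split => x /=; first by move/(DdomP _ e0) => [x1 xd]; apply/andP.
by move=> /andP[? ?]; exact/(DdomP _ e0).
Qed.

End measurability.

(** * Averaging *)

Section node_measurability.
Variables (R : realType) (k : nat) (h : R) (t : node_index k).
Notation mu := (@lebesgue_measure R).

Definition node_map (z : R * R) : R * R :=
  (node_center t z.1 (h * phi z.1) z.2, node_step t z.2 * (h * phi z.1)).

Lemma measurable_node_map : measurable_fun setT node_map.
Proof.
have mphi1 : measurable_fun [set: R * R] (fun z => phi z.1).
  exact: measurable_phi_comp.
have mstep : measurable_fun setT (fun z : R * R => node_step t z.2).
  by apply: measurable_funD => //; exact: measurable_funM.
have mhphi : measurable_fun setT (fun z : R * R => h * phi z.1).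
  exact: measurable_funM.
have mH : measurable_fun setT (fun z : R * R => node_step t z.2 * (h * phi z.1)).
  exact: measurable_funM.
apply: measurable_fun_pair => //; apply: measurable_funD.
  by apply: measurable_funD => //; exact: measurable_funM.
by apply: measurable_funM => //; exact: measurable_funM.
Qed.

Lemma measurable_partial_integral (I : set R) (F : R * R -> \bar R) :
  measurable I -> measurable_fun setT F -> (forall z, 0 <= F z)%E ->
  measurable_fun [set: R] (fun x => \int[mu]_(s in I) F (x, s))%E.
Proof.
move=> mI mF F0; pose F' (z : R * R) := (F z * (\1_I z.2)%:E)%E.
have F'0 z : (0 <= F' z)%E by rewrite mule_ge0// lee_fin.
have mF' : measurable_fun setT F'.
  apply: emeasurable_funM => //; apply/measurable_EFinP.
  by apply: measurableT_comp => //; exact: measurable_indic.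
rewrite (_ : (fun x => _) = fubini_F mu F'); last first.
  by apply/funext => x; rewrite integral_mkcond epatch_indic.
exact: (measurable_fun_fubini_tonelli_F (m2 := mu) F' mF' F'0).
Qed.

End node_measurability.

Section averaging.
Variables (R : realType) (k : nat) (h : R) (F : R * R -> \bar R) (S : \bar R).
Hypotheses (k0 : (0 < k)%N) (h0 : 0 < h).
Hypotheses (mF : measurable_fun setT F) (F0 : forall z, (0 <= F z)%E).
Local Open Scope ereal_scope.
Notation mu := (@lebesgue_measure R).

Hypothesis FS : forall s : R, (0 < s <= h)%R ->
  \int[mu]_(y in Ddom (k%:R * s)) F (y, s * phi y)%R <= S.

Let E : set R := Ddom (k.+1%:R * h)%R.
Let kh0 : (0 <= k.+1%:R * h)%R. Proof. by rewrite mulr_ge0// ltW. Qed.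
Let mE : measurable E. Proof. exact: measurable_Ddom. Qed.

(** The pairs [(y, h' phi y)] with [0 < h' <= h] and [y] in [Ddom (k h')], on which [FS] gives
    control. Cutting [F] down to them lets the integrals run over the whole plane. *)
Let admissible (z : R * R) : bool :=
  [&& (0 < z.2)%R, (z.2 <= h * phi z.1)%R & (`|z.1| <= 1 - k%:R * z.2 / 2)%R].

Let G z := if admissible z then F z else 0.
Let G0 z : 0 <= G z. Proof. by rewrite /G; case: ifP. Qed.

Let mphi1 : measurable_fun [set: R * R] (fun z => phi z.1).
Proof. exact: measurable_phi_comp. Qed.

Let mG : measurable_fun setT G.
Proof.
apply: measurable_fun_ifT => //; apply: measurable_and.
  exact: measurable_fun_ltr.
apply: measurable_and.
  by apply: measurable_fun_ler => //; exact: measurable_funM.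
apply: measurable_fun_ler; first exact: measurableT_comp.
apply: measurable_funB => //; apply: measurable_funM => //.
exact: measurable_funM.
Qed.

(* By [subinterval_phi_le], 2 / phi y dominates 1 / phi x; it is the density of
   the substitution s = h' phi y. *)
Let K z := (2 * (phi z.1)^-1)%:E * G z.
Let K0 z : 0 <= K z.
Proof. by rewrite mule_ge0// lee_fin mulr_ge0// invr_ge0 phi_ge0. Qed.

Let mK : measurable_fun setT K.
Proof.
apply: emeasurable_funM => //; apply/measurable_EFinP.
apply: measurable_funM => //.
rewrite (_ : (fun z => _) = (fun z : R * R => (phi z.1 `^ (-1))%R)).
  by have := measurableT_comp (measurable_powR (-1)%R) mphi1.
by apply/funext => z; rewrite powR_inv1// phi_ge0.
Qed.

Let S0 : 0 <= S.
Proof.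
apply: le_trans (FS (s := h) _); last by rewrite h0 lexx.
by apply: integral_ge0 => y _.
Qed.

(** By Tonelli the parameter [s] becomes the outer variable. The inner integral is at most [S] by
    [FS] for [0 < s <= h], and zero for other [s]. *)
Let integral_GS : \int[mu]_y \int[mu]_s G (y, s * phi y)%R <= h%:E * S.
Proof.
pose G' (z : R * R) := G (z.1, z.2 * phi z.1)%R.
have mG' : measurable_fun setT G'.
  apply: (measurableT_comp mG); apply: measurable_fun_pair => //.
  exact: measurable_funM.
rewrite (fubini_tonelli (m1 := mu) (m2 := mu) G')//; last by move=> z; exact: G0.
have mI : measurable_fun setT (fun s => \int[mu]_y G' (y, s)).
  exact: (measurable_fun_fubini_tonelli_G (m1 := mu) G' mG' (fun z => G0 _)).
apply: (@le_trans _ _ (\int[mu]_s ((cst S) \_ `]0%R, h]) s)).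
  apply: ge0_le_integral => //.
  - by move=> s _; apply: integral_ge0 => y _; exact: G0.
  - by apply: (measurable_restrictT _ _).1.
  move=> s _; rewrite patchE; case: ifPn => [|] /=.
    rewrite inE /= in_itv /= => sh; apply: le_trans (FS sh).
    have s0 : (0 < s)%R by case/andP: sh.
    have ks : (0 <= k%:R * s)%R by rewrite mulr_ge0// ltW.
    rewrite [leRHS]integral_mkcond; apply: ge0_le_integral => //.
    + by move=> y _; exact: G0.
    + exact: measurable_fun_pair1.
    + apply: (measurable_restrictT _ _).1; first exact: measurable_Ddom.
      apply: measurable_funTS; apply: (measurableT_comp mF).
      apply: measurable_fun_pair => //; apply: measurable_funM => //.
      exact: measurable_phi.
    move=> y _; rewrite /G' /G /=.
    case: ifPn => [/and3P[/= p1 p2 p3]|_]; last by rewrite patchE; case: ifP.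
    rewrite patchE mem_set//; apply/DdomP => //; split; last by rewrite mulrA in p3.
    rewrite pmulr_rgt0// in p1; rewrite (le_lt_trans p3)// gtrBl.
    by rewrite divr_gt0 ?mulr_gt0 ?ltr0n.
  (* Admissibility of [(y, s phi y)] forces [phi y > 0]; cancelling it gives [0 < s <= h]. *)
  move=> sh; rewrite integral0_eq// => y _; rewrite /G' /G /admissible /=.
  case: ifPn => // /and3P[p1 p2 _]; exfalso; move/negP: sh; apply.
  have py : (0 < phi y)%R.
    rewrite lt_neqAle phi_ge0 andbT; apply: contraTneq p1 => <-.
    by rewrite mulr0 ltxx.
  rewrite inE /= in_itv /=; move: p1 p2.
  by rewrite pmulr_lgt0// ler_pM2r// => -> ->.
rewrite -integral_mkcond integral_cst//= lebesgue_measure_itv /= lte_fin h0.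
by rewrite oppr0 adde0 muleC.
Qed.

(** For fixed [y], the map sending [s] to [s / phi y] has expansion constant [1 / phi y]. The
    resulting factor [phi y] cancels the one in the density [2 / phi y]. *)
Let integral_K : \int[mu]_y \int[mu]_s K (y, s) <= 2%:E * (h%:E * S).
Proof.
pose G' (z : R * R) := G (z.1, z.2 * phi z.1)%R.
have mG' : measurable_fun setT G'.
  apply: (measurableT_comp mG); apply: measurable_fun_pair => //.
  exact: measurable_funM.
apply: le_trans (lee_wpmul2l _ integral_GS); last by rewrite lee_fin.
rewrite -ge0_integralZl//; last 2 first.
- exact: (measurable_fun_fubini_tonelli_F (m2 := mu) G' mG' (fun z => G0 _)).
- by move=> y _; apply: integral_ge0 => s _; exact: G0.
apply: ge0_le_integral => //.
- by move=> y _; apply: integral_ge0 => s _; exact: K0.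
- exact: (measurable_fun_fubini_tonelli_F (m2 := mu) K mK K0).
- apply: measurable_funeM.
  exact: (measurable_fun_fubini_tonelli_F (m2 := mu) G' mG' (fun z => G0 _)).
move=> y _; have [py|] := ltP 0%R (phi y); last first.
  (* If [phi y] vanishes, no [s] is admissible. *)
  move=> py; rewrite integral0_eq ?mule_ge0 ?integral_ge0// => s _.
  rewrite /K /G /admissible /=.
  case: ifPn => [/and3P[s0 sy _]|]; last by rewrite mule0.
  by have := lt_le_trans s0 sy; rewrite ltNge mulr_ge0_le0// ltW.
have mGy : measurable_fun [set: R] (fun s : R => G (y, s * phi y)%R).
  exact: (measurable_fun_pair2 y mG').
have mpsi : measurable_fun [set: R] (fun s : R => (phi y)^-1 * s)%R.
  exact: measurable_funM.
have KE (s : R) : K (y, s) = (2 * (phi y)^-1)%:E * G (y, (phi y)^-1 * s * phi y)%R.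
  by congr (_ * G (_, _)); rewrite mulrC mulrA mulfV ?mul1r// gt_eqF.
under eq_integral => s _ do rewrite KE.
rewrite ge0_integralZl//; last 2 first.
- exact: (measurableT_comp mGy mpsi).
- by rewrite lee_fin mulr_ge0// invr_ge0 ltW.
rewrite EFinM -muleA; apply: lee_wpmul2l => //.
rewrite lee_pdivrMl// -[X in _ <= X%:E * _]invrK.
apply: (@integral_expanding_le R setT (fun s => ((phi y)^-1 * s)%R) _ _ _ _ _
  (fun s => G (y, s * phi y)%R)) => //.
- by rewrite invr_gt0.
- by move=> u v _ _; rewrite -mulrBr normrM ger0_norm// invr_ge0 ltW.
Qed.

Variable t : node_index k.
Let a : R := (node_base R t * h)%R.
Let b : R := (node_sign R t * k%:R / 2)%R.

Let a_le : (`|a| <= k.+1%:R * h / 2)%R.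
Proof. by rewrite /a normrM (gtr0_norm h0) mulrAC ler_wpM2r ?node_base_le// ltW. Qed.

Let mnode : measurable_fun setT
  (fun z : R * R => (z.1 + a * phi z.1 + b * z.2, z.2)%R).
Proof.
apply: measurable_fun_pair => //.
apply: measurable_funD; last exact: measurable_funM.
by apply: measurable_funD => //; exact: measurable_funM.
Qed.

(** In the coordinates [(x, s)], with the step [s] in place of sigma, the center is for each fixed
    [s] a translate of the map of [node_map_expanding]. *)
Let L (z : R * R) := K (z.1 + a * phi z.1 + b * z.2, z.2)%R.
Let mL : measurable_fun setT L. Proof. exact: measurableT_comp mK mnode. Qed.
Let L0 z : 0 <= L z. Proof. exact: K0. Qed.

(** A factor 2 comes from the expansion constant 1/2 in [x] at fixed [s], the other from
    [integral_K]. *)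
Let integral_L : \int[mu]_(x in E) \int[mu]_s L (x, s) <= 4%:E * (h%:E * S).
Proof.
pose L' (z : R * R) := L z * (\1_E z.1)%:E.
have L'0 z : 0 <= L' z by rewrite mule_ge0// lee_fin.
have mL' : measurable_fun setT L'.
  apply: emeasurable_funM => //; apply/measurable_EFinP.
  by apply: measurableT_comp => //; exact: measurable_indic.
have -> : \int[mu]_(x in E) \int[mu]_s L (x, s) = \int[mu]_x \int[mu]_s L' (x, s).
  rewrite integral_mkcond epatch_indic; apply: eq_integral => x _ /=.
  rewrite muleC -ge0_integralZl//; last exact: (measurable_fun_pair2 x mL).
  by apply: eq_integral => s _; rewrite muleC.
rewrite (fubini_tonelli (m1 := mu) (m2 := mu) L')//.
apply: (@le_trans _ _ (\int[mu]_s (2%:E * \int[mu]_y K (y, s)))).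
  apply: ge0_le_integral => //.
  - by move=> s _; apply: integral_ge0 => x _; exact: L'0.
  - exact: (measurable_fun_fubini_tonelli_G (m1 := mu) L' mL' L'0).
  - apply: measurable_funeM.
    exact: (measurable_fun_fubini_tonelli_G (m1 := mu) K mK K0).
  move=> s _; rewrite [leLHS](_ : _ = \int[mu]_(x in E) L (x, s)); last first.
    by rewrite [RHS]integral_mkcond epatch_indic.
  rewrite -[X in _ <= X%:E * _]invrK.
  apply: (@integral_expanding_le R E (fun x => x + a * phi x + b * s)%R _ _ _ _ _
    (fun y => K (y, s))) => //.
  - move=> x y xE yE.
    have := node_map_expanding kh0 a_le xE yE; congr (_ <= `|_|)%R.
    by ring.
  - apply: measurable_funD => //; apply: measurable_funD => //.
    by apply: measurable_funM => //; exact: measurable_phi.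
  - exact: measurable_fun_pair1.
rewrite ge0_integralZl//; last 2 first.
- exact: (measurable_fun_fubini_tonelli_G (m1 := mu) K mK K0).
- by move=> s _; apply: integral_ge0 => y _; exact: K0.
rewrite -(fubini_tonelli (m1 := mu) (m2 := mu) K)//.
have -> : 4%:E * (h%:E * S) = 2%:E * (2%:E * (h%:E * S)).
  by rewrite [RHS]muleA -EFinM -natrM.
by apply: lee_wpmul2l => //; exact: integral_K.
Qed.

(** At fixed [x], sigma is traded for the step [s], with slope [c h phi x]; then [integral_L]
    applies. The constant is [4 / c <= 16], and [h] cancels. *)
Lemma averaging_le :
  \int[mu]_(x in Ddom (k.+1%:R * h)%R) \int[mu]_(sigma in `]0%R, k%:R^-1%R[)
    F (node_map h t (x, sigma))
  <= 16%:E * S.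
Proof.
pose c : R := node_slope R t; have c0 : (4^-1 <= c)%R := node_slope_ge _ _.
have c1 : (0 < c)%R by rewrite (lt_le_trans _ c0).
have px x : E x -> (0 < phi x)%R.
  by move=> xE; apply: phi_gt0; exact: Ddom_norm_lt1 xE.
have mint : measurable_fun [set: R] (fun x => \int[mu]_s L (x, s)).
  exact: (measurable_fun_fubini_tonelli_F (m2 := mu) L mL L0).
pose I : set R := `]0%R, k%:R^-1%R[%classic.
pose N := node_map h t.
have mN : measurable_fun setT N by exact: measurable_node_map.
have mFN : measurable_fun setT (fun z => F (N z)) by exact: measurableT_comp mF mN.
have NE x sigma : N (x, sigma) = (x + a * phi x +
    b * (node_step t sigma * (h * phi x)), node_step t sigma * (h * phi x))%R.
  by rewrite /N /node_map /node_center /= /a /b; congr pair; ring.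
apply: (@le_trans _ _ (\int[mu]_(x in E) ((c * h)^-1%:E * \int[mu]_s L (x, s)))).
  apply: ge0_le_integral => //.
  - by move=> x _; apply: integral_ge0 => s _; exact: F0.
  - apply: measurable_funTS.
    exact: (measurable_partial_integral (measurable_itv _) mFN (fun z => F0 _)).
  - by apply: measurable_funeM; exact: measurable_funTS.
  move=> x xE; have x0 := px _ xE.
  have H0 : (0 < h * phi x)%R by rewrite mulr_gt0.
  pose psi (sigma : R) := (node_step t sigma * (h * phi x))%R.
  have mpsi : measurable_fun [set: R] psi.
    by apply: measurable_funM => //; apply: measurable_funD.
  have mLx : measurable_fun [set: R] (fun s : R => L (x, s)).
    exact: measurable_fun_pair2.
  have mLpsi : measurable_fun I (fun s : R => L (x, psi s)).
    by apply: measurable_funTS; exact: (measurableT_comp mLx mpsi).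
  (* By the subinterval lemmas the pair is admissible and [phi x] times the density [2 / phi y] is
     at least 1. *)
  apply: (@le_trans _ _ (\int[mu]_(sigma in I) ((phi x)%:E * L (x, psi sigma)))).
    apply: ge0_le_integral => //.
    + by apply: measurable_funTS; exact: (measurable_fun_pair2 x mFN).
    + exact: measurable_funeM.
    move=> sigma /=; rewrite in_itv /= => /andP[s0 s1].
    rewrite -/N NE /L /K /= -/(psi sigma).
    set y := (x + a * phi x + b * psi sigma)%R.
    have st0 : (0 < psi sigma)%R by rewrite mulr_gt0// node_step_gt0.
    have stx : (psi sigma <= h * phi x / 2)%R.
      by rewrite [leRHS]mulrC ler_wpM2r ?(ltW H0)// node_step_le.
    have yx : (`|y - x| + k%:R * psi sigma / 2 <= k.+1%:R * (h * phi x) / 2)%R.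
      have -> : y = (N (x, sigma)).1 by rewrite NE.
      exact: (node_subinterval k0 t x (ltW H0) s0 s1).
    have y1 := subinterval_norm_le h0 xE yx.
    have y2 := subinterval_phi_le k0 h0 xE st0 yx.
    have y3 := subinterval_step_le k0 h0 xE st0 stx yx.
    have y0 : (0 < phi y)%R by rewrite -(pmulr_rgt0 _ h0) (lt_le_trans st0).
    rewrite /G /admissible /= st0 y1 y3 /= muleA -EFinM lee_pemull// lee_fin.
    by rewrite mulrA ler_pdivlMr// mul1r mulrC.
  rewrite ge0_integralZl//; last 2 first.
  - exact: measurable_itv.
  - by rewrite lee_fin ltW.
  have -> : (c * h)^-1%R = (phi x * (c * (h * phi x))^-1)%R.
    by field; rewrite !gt_eqF.
  rewrite EFinM -muleA; apply: lee_wpmul2l; first by rewrite lee_fin ltW.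
  apply: (@integral_expanding_le R I psi (c * (h * phi x))%R _ _ _ _
    (fun s => L (x, s))) => //.
  - exact: mulr_gt0.
  - move=> u v _ _; rewrite /psi -mulrBl normrM (gtr0_norm H0).
    rewrite /node_step opprD addrACA subrr add0r -mulrBr normrM (gtr0_norm c1).
    by rewrite mulrAC.
  - exact: measurable_itv.
rewrite ge0_integralZl//; last 3 first.
- exact: measurable_funTS.
- by move=> x _; apply: integral_ge0 => s _; exact: L0.
- by rewrite lee_fin invr_ge0 mulr_ge0// ltW.
rewrite lee_pdivrMl ?mulr_gt0//; apply: (le_trans integral_L).
rewrite !muleA; apply: lee_wpmul2r => //.
by rewrite -!EFinM lee_fin; have := ler_wpM2r (ltW h0) c0; lra.
Qed.

End averaging.

(* The function v is z^p up to a constant when p is finite, and the indicator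
   of z > M when p = +oo, which allows a common treatment of both cases. *)
Section borel_case.
Variables (R : realType) (k : nat) (g : R -> R) (xi zeta : R) (v : R -> \bar R).
Hypotheses (k0 : (0 < k)%N) (mg : measurable_fun [set: R] g).
Hypotheses (xi0 : 0 <= xi) (zeta0 : 0 <= zeta).
Hypotheses (mv : measurable_fun [set: R] v) (v0 : forall z, (0 <= v z)%E).
Hypothesis vmono : forall z w, 0 <= z -> z <= w -> (v z <= v w)%E.
Notation mu := (@lebesgue_measure R).

Lemma measurable_fwd_diff d (T : measurableType d) n (f1 f2 : T -> R) :
  measurable_fun setT f1 -> measurable_fun setT f2 ->
  measurable_fun setT (fun x => fwd_diff n g (f1 x) (f2 x)).
Proof.
move=> m1 m2; apply: measurable_sum => i; apply: measurable_funM => //.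
apply: (measurableT_comp mg); apply: measurable_funD => //.
exact: measurable_funM.
Qed.

(** Unlike in [Wweight], [delta] is the full length of the support, with no factor phi. The same
    formula then serves at [x] with step [h phi x] and at a node with an arbitrary step. *)
Definition weighted_diff n (delta y s : R) : R :=
  (1 - y - delta / 2) `^ xi * (1 + y - delta / 2) `^ zeta *
  fwd_diff n g (y - n%:R * s / 2) s.

Lemma measurable_weighted_diff d (T : measurableType d) n (f0 f1 f2 : T -> R) :
  measurable_fun setT f0 -> measurable_fun setT f1 -> measurable_fun setT f2 ->
  measurable_fun setT (fun x => weighted_diff n (f0 x) (f1 x) (f2 x)).
Proof.
move=> m0 m1 m2; have m0' : measurable_fun setT (fun x => f0 x / 2).
  exact: measurable_funM.
apply: measurable_funM; last first.
  apply: measurable_fwd_diff => //; apply: measurable_funB => //.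
  by apply: measurable_funM => //; exact: measurable_funM.
apply: measurable_funM.
  apply: (measurableT_comp (measurable_powR xi)).
  by apply: measurable_funB => //; exact: measurable_funB.
apply: (measurableT_comp (measurable_powR zeta)).
by apply: measurable_funB => //; exact: measurable_funD.
Qed.

Lemma measurable_weighted_diff_phi n (s : R) : measurable_fun [set: R]
  (fun x => weighted_diff n (n%:R * (s * phi x)) x (s * phi x)).
Proof.
have ms : measurable_fun [set: R] (fun x : R => s * phi x).
  by apply: measurable_funM => //; exact: measurable_phi.
by apply: measurable_weighted_diff => //; exact: measurable_funM.
Qed.

Variables (h : R) (S : \bar R).
Hypothesis h0 : 0 < h.
Hypothesis HS : forall s, 0 < s <= h ->
  (\int[mu]_(y in Ddom (k%:R * s))
     v `|weighted_diff k (k%:R * (s * phi y)) y (s * phi y)| <= S)%E.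

Let K := node_const R k.
Let E : set R := Ddom (k.+1%:R * h).
Let kh0 : 0 <= k.+1%:R * h. Proof. by rewrite mulr_ge0// ltW. Qed.
Let I : set R := `]0, k%:R^-1[%classic.
Let F (z : R * R) : \bar R := v `|weighted_diff k (k%:R * z.2) z.1 z.2|.
Let F0 z : (0 <= F z)%E. Proof. exact: v0. Qed.

Let mF : measurable_fun setT F.
Proof.
apply: (measurableT_comp mv); apply: measurableT_comp => //.
by apply: measurable_weighted_diff => //; exact: measurable_funM.
Qed.

Let U (x : R) : \bar R :=
  v (`|weighted_diff k.+1 (k.+1%:R * (h * phi x)) x (h * phi x)| / K).

Let mU : measurable_fun [set: R] U.
Proof.
apply: (measurableT_comp mv); apply: measurable_funM => //.
by apply: measurableT_comp => //; exact: measurable_weighted_diff_phi.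
Qed.

(** The index supplied by [norm_central_diffS] varies with [x] and sigma; summing over all indices
    gives a bound suited to integration. *)
Let pointwise x sigma : E x -> I sigma ->
  (U x <= \sum_(t : node_index k) F (node_map h t (x, sigma)))%E.
Proof.
move=> xE; rewrite /I /= in_itv /= => /andP[s0 s1].
have [t Ht] := norm_central_diffS k0 g x (h * phi x) sigma.
have K0 : 0 < K := node_const_gt0 R k0.
have [x1 xd] := (DdomP _ kh0).1 xE.
have H0 : 0 < h * phi x by rewrite mulr_gt0// phi_gt0.
rewrite (bigD1 t)//=.
apply: (@le_trans _ _ (F (node_map h t (x, sigma)))); last first.
  by rewrite leeDl// sume_ge0.
have sub := node_subinterval k0 t x (ltW H0) s0 s1.
rewrite /U /F /node_map /=.
set y := node_center _ _ _ _ in Ht sub *; set s := _ * (h * phi x) in Ht sub *.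
apply: vmono; first by rewrite divr_ge0// ltW.
rewrite ler_pdivrMr// /weighted_diff.
have := sub; have := ler_norm (y - x); have := ler_norm (x - y).
rewrite (distrC x) => n1 n2 n3.
have p1 : 0 <= 1 - x - k.+1%:R * (h * phi x) / 2.
  by have := ler_norm x; lra.
have p2 : 0 <= 1 + x - k.+1%:R * (h * phi x) / 2.
  by have := ler_norm (- x); rewrite normrN; lra.
rewrite !normrM !(ger0_norm (powR_ge0 _ _)).
(* The smaller support is contained in J, so its ends are at least as far from the endpoints;
   nonnegative exponents preserve this. *)
have W : (1 - x - k.+1%:R * (h * phi x) / 2) `^ xi *
    (1 + x - k.+1%:R * (h * phi x) / 2) `^ zeta <=
    (1 - y - k%:R * s / 2) `^ xi * (1 + y - k%:R * s / 2) `^ zeta.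
  by apply: ler_pM; rewrite ?powR_ge0//; apply: ge0_ler_powR; rewrite ?nnegrE//; lra.
have W0 : 0 <= (1 - x - k.+1%:R * (h * phi x) / 2) `^ xi *
    (1 + x - k.+1%:R * (h * phi x) / 2) `^ zeta by rewrite mulr_ge0 ?powR_ge0.
apply: le_trans (ler_pM W0 (normr_ge0 _) W Ht) _.
by rewrite [X in _ * X]mulrC mulrA.
Qed.

(** The factors are the inverse length of [I], the number of indices, and the constant of
    [averaging_le]. *)
Lemma integral_weighted_diffS_le :
  (\int[mu]_(x in Ddom (k.+1%:R * h))
      v (`|weighted_diff k.+1 (k.+1%:R * (h * phi x)) x (h * phi x)| / K)
   <= (k%:R * #|{: node_index k}|%:R * 16)%:E * S)%E.
Proof.
have mE : measurable E by exact: measurable_Ddom.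
have mI : measurable I by exact: measurable_itv.
have mFt (t : node_index k) : measurable_fun setT (fun z => F (node_map h t z)).
  exact: (measurableT_comp mF (measurable_node_map h t)).
have mP (t : node_index k) : measurable_fun [set: R]
    (fun x => \int[mu]_(sigma in I) F (node_map h t (x, sigma)))%E.
  by apply: (measurable_partial_integral (F := fun z => F (node_map h t z))).
have m2 (t : node_index k) (x : R) :
    measurable_fun [set: R] (fun s : R => F (node_map h t (x, s))).
  exact: (measurableT_comp (mFt t) (pair1_measurable x)).
have FS (s : R) : 0 < s <= h ->
    (\int[mu]_(y in Ddom (k%:R * s)) F (y, (s * phi y)%R) <= S)%E.
  by move=> /HS.
have lI : mu I = (k%:R^-1)%:E.
  by rewrite /I lebesgue_measure_itv /= lte_fin invr_gt0 ltr0n k0 oppr0 adde0.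
rewrite -[leLHS]/(\int[mu]_(x in E) U x)%E.
apply: (@le_trans _ _ (\int[mu]_(x in E) (k%:R%:E *
    \sum_(t : node_index k) \int[mu]_(sigma in I) F (node_map h t (x, sigma))))%E).
  apply: ge0_le_integral => //.
  - by move=> x _; exact: v0.
  - exact: measurable_funTS.
  - apply: measurable_funeM; apply: emeasurable_sum => t; apply: measurable_funTS.
    exact: mP.
  (* [U x] is constant in sigma and [I] has measure [1 / k], so [U x / k] is its integral over
     [I]. *)
  move=> x xE; rewrite -lee_pdivrMl ?ltr0n//.
  rewrite -ge0_integral_sum//; last first.
    by move=> t; apply: measurable_funTS; exact: m2.
  rewrite muleC -lI -integral_cst//; apply: ge0_le_integral => //.
  - by move=> s _; exact: v0.
  - apply: emeasurable_sum => t; apply: measurable_funTS.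
    exact: m2.
  - by move=> s sI; exact: pointwise.
rewrite ge0_integralZl//; last 2 first.
- apply: emeasurable_sum => t; apply: measurable_funTS.
  exact: mP.
- by move=> x _; apply: sume_ge0 => t _; apply: integral_ge0 => s _; exact: F0.
rewrite -mulrA EFinM -muleA; apply: lee_wpmul2l => //.
rewrite ge0_integral_sum//; last 2 first.
- move=> t; apply: measurable_funTS.
  exact: mP.
- by move=> t x _; apply: integral_ge0 => s _; exact: F0.
apply: (@le_trans _ _ (\sum_(t : node_index k) 16%:E * S)%E).
  apply: lee_sum => t _; exact: (averaging_le k0 h0 mF F0 FS).
by rewrite sumr_const EFinM -muleA [leRHS]mule_natl.
Qed.

End borel_case.

(** * Lebesgue and Borel measurability *)

Section lebesgue_borel.
Variable R : realType.
Notation mu := (@lebesgue_measure R).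
Notation cmu := (@completed_lebesgue_measure R).

Lemma borel_lebesgue_measurable (A : set R) :
  measurable A -> measurable (A : set (lebesgueR R)).
Proof. by move=> mA; exact: sub_caratheodory. Qed.

Lemma measurable_fun_lebesgue d (T : measurableType d) (D : set R) (f : R -> T) :
  measurable D -> measurable_fun D f -> @measurable_fun _ _ (lebesgueR R) T D f.
Proof.
by move=> mD mf _ Y mY; apply: borel_lebesgue_measurable; exact: mf.
Qed.

(** The identity, as a map from the completed space to the Borel one, pushes one measure forward to
    the other. *)
Lemma integral_completed (f : R -> \bar R) :
  measurable_fun [set: R] f -> (forall x, 0 <= f x)%E ->
  (\int[cmu]_x f x = \int[mu]_x f x)%E.
Proof.
move=> mf f0.
have mid : @measurable_fun _ _ (lebesgueR R) (measurableTypeR R) setT id.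
  exact: measurable_fun_lebesgue.
rewrite -[LHS](@ge0_integral_pushforward _ _ (lebesgueR R) (measurableTypeR R) R
  id mid cmu setT)//.
Qed.

(** A set of outer measure zero is Carathéodory measurable. *)
Lemma null_negligible (N : set R) : mu N = 0%E -> cmu.-negligible N.
Proof.
move=> N0; exists N; split => //.
apply: le_caratheodory_measurable => /= X.
have -> : ((wlength idfun)^*)%mu (X `&` N) = 0%E.
  apply/eqP; rewrite eq_le outer_measure_ge0 andbT -N0.
  by apply: le_outer_measure; exact: subIsetr.
by rewrite add0e; apply: le_outer_measure; exact: subIsetl.
Qed.

Lemma negligible_null (N : set R) : cmu.-negligible N -> mu N = 0%E.
Proof.
move=> [A [mA A0 NA]]; apply/eqP; rewrite eq_le measure_ge0 andbT -A0.
exact: (le_outer_measure ((wlength idfun)^*)%mu).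
Qed.

Lemma lebesgue_measurable_decomp (A : set R) : measurable (A : set (lebesgueR R)) ->
  exists B M : set R, [/\ measurable B, measurable M, mu M = 0%E,
    B `<=` A & A `<=` B `|` M].
Proof.
rewrite /measurable /= => mA.
have : (completed_algebra_gen mu).-sigma.-measurable A.
  by rewrite completed_caratheodory_measurable.
rewrite g_sigma_completed_algebra_genE => -[B mB [N [M [mM M0 NM]] BN]].
exists B, M; split => //; first by rewrite -BN; exact: subsetUl.
by rewrite -BN; exact: setUS.
Qed.

(** Each set where [g > q], with [q] rational, is Borel up to a null set. Off the union of these
    countably many null sets, the rational levels determine all the others. *)
Lemma borel_version (D : set R) (g : R -> R) : measurable D ->
  lebesgue_measurable_fun D g ->
  exists (g' : R -> R) (M : set R), [/\ measurable_fun [set: R] g', mu M = 0%E &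
    forall x, D x -> ~ M x -> g' x = g x].
Proof.
move=> mD mg.
pose A (q : rat) : set R := D `&` g @^-1` `]ratr q, +oo[%classic.
have mA q : measurable (A q : set (lebesgueR R)).
  apply: mg; first exact: borel_lebesgue_measurable.
  exact: measurable_itv.
have /choice[B HB] : forall q, exists B : set R, exists M : set R,
    [/\ measurable B, measurable M, mu M = 0%E, B `<=` A q & A q `<=` B `|` M].
  by move=> q; exact: lebesgue_measurable_decomp.
have /choice[M HM] := HB.
pose MM : set R := \bigcup_(q : rat) M q.
have mMM : measurable MM.
  by apply: bigcupT_measurable_rat => q; case: (HM q).
have MM0 : mu MM = 0%E.
  apply: (negligibleP mu mMM).1.
  pose F n : set R := if unpickle n is Some q then M q else set0.
  have : mu.-negligible (\bigcup_n F n).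
    apply: negligible_bigcup => n; rewrite /F; case: unpickle => [q|].
      by have [_ mM M0 _ _] := HM q; exact: (negligibleP mu mM).2.
    exact: negligible_set0.
  apply: negligibleS => x [q _ Mq].
  exists (pickle q); first exact: I.
  by rewrite /F pickleK.
exists (g \_ (D `\` MM)), MM; split => //; last first.
  by move=> x Dx Mx; rewrite patchE mem_set.
have mDM : measurable (D `\` MM) by exact: measurableD.
apply: (measurable_restrictT _ mDM).1.
apply: (measurability _ (RGenOInfty.measurableE R)) => _ [_ [a ->] <-].
(* [g x > a] holds exactly when [g x > q > a] for some rational [q], and off [MM] the set [A q] may
   be replaced by [B q]. *)
rewrite (_ : _ `&` _ = \bigcup_(q in [set q | a < ratr q]) (B q `\` MM)).
  rewrite bigcup_mkcond; apply: bigcupT_measurable_rat => q; case: ifP => // _.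
  by apply: measurableD => //; case: (HM q).
apply/seteqP; split => x /=.
  move=> [[Dx Mx]]; rewrite in_itv /= andbT => ag.
  have [q] := rat_in_itvoo ag; rewrite in_itv /= => /andP[aq qg].
  exists q => //; split => //.
  have [_ _ _ _ AB] := HM q; case: (AB x) => //.
    by split => //=; rewrite in_itv /= qg.
  by move=> Mq; exfalso; apply: Mx; exists q.
move=> [q aq [Bx Mx]]; have [_ _ _ BA _] := HM q.
have [Dx /=] := BA _ Bx; rewrite in_itv /= andbT => qg.
by split => //; rewrite in_itv /= (lt_trans aq qg).
Qed.

End lebesgue_borel.

(** * Norms expressed through a Borel representative *)

Section Lp_norm_borel.
Variable R : realType.
Notation mu := (@lebesgue_measure R).
Notation cmu := (@completed_lebesgue_measure R).
Variables (D N : set R) (f f' : R -> R).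
Hypotheses (mD : measurable D) (mf' : measurable_fun [set: R] f').
Hypotheses (N0 : mu N = 0%E) (ff' : forall x, D x -> ~ N x -> f x = f' x).

Let F' (x : R) : \bar R := (EFin \o f' \_ D) x.

Let mF' : measurable_fun [set: R] F'.
Proof.
rewrite /F'; apply/measurable_EFinP.
by apply: (measurable_restrictT _ mD).1; exact: measurable_funTS.
Qed.

Let negN : cmu.-negligible N. Proof. exact: null_negligible. Qed.

Let FF' x : ~ N x -> (EFin \o f \_ D) x = F' x.
Proof.
move=> Nx; rewrite /F' /= !patchE; case: ifPn => // xD.
by rewrite ff'//; exact/set_mem.
Qed.

Lemma Lp_norm_EFin (r : R) : 0 < r ->
  (Lp_norm r%:E D f = (\int[mu]_(x in D) (`|f' x| `^ r)%:E) `^ r^-1)%E.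
Proof.
move=> r0; rewrite /Lp_norm unlock; congr (_ `^ _)%E.
have mG : measurable_fun [set: R] (fun x => `|F' x| `^ r)%E.
  by apply: (measurableT_comp (measurable_poweR r)); exact: measurableT_comp.
have mG' := measurable_fun_lebesgue measurableT mG.
have ae : ae_eq cmu setT (fun x => `|F' x| `^ r)%E
    (fun x => `|(EFin \o f \_ D) x| `^ r)%E.
  case: negN => M [mM M0 NM]; exists M; split => // x h; apply: NM.
  by apply: contrapT => Nx; apply: h => _; rewrite (FF' Nx).
rewrite -(@ae_eq_integral _ (lebesgueR R) R cmu setT _ _ measurableT mG' _ ae);
  last first.
  (* Completeness carries measurability over to the original integrand. *)
  exact: (ae_measurable_fun completed_lebesgue_measure_is_complete ae mG').
rewrite (integral_completed mG) => [|x]; last exact: poweR_ge0.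
rewrite [RHS]integral_mkcond; apply: eq_integral => x _.
rewrite /F' /= !patchE; case: ifPn => // _.
(* Outside [D] the restriction takes the default value [point], which is 0 in [R]. *)
rewrite -[point in LHS]/(0 : R) -[RHS]/(0%E : \bar R) normr0 /= powR0//.
by rewrite gt_eqF.
Qed.

Lemma Lp_norm_infty_le (M : R) : 0 <= M ->
  (Lp_norm +oo D f <= M%:E)%E <-> mu (D `&` [set x | M < `|f' x|]) = 0%E.
Proof.
move=> M0; rewrite /Lp_norm unlock.
have muT : (0 < cmu [set: R])%E.
  rewrite (_ : cmu setT = mu `]-oo, +oo[%classic); last by rewrite set_itvNyy.
  by rewrite lebesgue_measure_itv /= ltry.
rewrite muT; split.
  move/ess_supP => [A [mA A0 HA]]; apply: negligible_null.
  have : cmu.-negligible (A `|` N).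
    by apply: negligibleU => //; exists A; split.
  apply: negligibleS => x [Dx /= Mx]; have [Nx|Nx] := pselect (N x); [by right|left].
  have [E] := FF' Nx; apply: HA => /=; rewrite E patchE mem_set//= lee_fin.
  by apply/negP; rewrite -ltNge.
move=> h; apply/ess_supP.
have : cmu.-negligible ((D `&` [set x | M < `|f' x|]) `|` N).
  by apply: negligibleU => //; exact: null_negligible.
apply: negligibleS => x /= /negP; rewrite -ltNge => Mx.
have [Nx|Nx] := pselect (N x); [by right|left].
move: Mx; have [->] := FF' Nx; rewrite patchE; case: ifPn => [xD|_] /=.
  by rewrite lte_fin => ?; split => //; exact: set_mem.
by rewrite -[point]/(0 : R) normr0 lte_fin ltNge M0.
Qed.

End Lp_norm_borel.

(** * The modulus of smoothness *)

Section borel_modulus.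
Variable R : realType.
Notation mu := (@lebesgue_measure R).
Notation cmu := (@completed_lebesgue_measure R).

Lemma sym_diff_Ddom n (h : R) (g : R -> R) x : 0 <= h -> Ddom (n%:R * h) x ->
  sym_diff n (h * phi x) g x =
  fwd_diff n g (x - n%:R * (h * phi x) / 2) (h * phi x).
Proof.
move=> h0 xD; have nh0 : 0 <= n%:R * h by rewrite mulr_ge0.
have [_ xd] := (DdomP _ nh0).1 xD.
rewrite /sym_diff; case: asboolP => // -[] y /=; rewrite !in_itv /= => /andP[y1 y2].
have := ler_norm x; have := ler_norm (- x); rewrite normrN => a1 a2.
by apply/andP; split; rewrite bnd_simp; lra.
Qed.

Variables (g g' : R -> R) (N : set R) (xi zeta : R).
Hypotheses (N0 : mu N = 0%E).
Hypothesis gg' : forall x, -1 < x < 1 -> ~ N x -> g' x = g x.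

(** Each node [psi i x] is an expanding function of [x] on the domain, so the points having a node
    in a null set form a null set. *)
Lemma sym_diff_borel n (h : R) : 0 < h -> exists M : set R, mu M = 0%E /\
  forall x, Ddom (n%:R * h) x -> ~ M x ->
    Wweight (n%:R * h) xi zeta x * sym_diff n (h * phi x) g x =
    weighted_diff g' xi zeta n (n%:R * (h * phi x)) x (h * phi x).
Proof.
move=> h0; have nh0 : 0 <= n%:R * h by rewrite mulr_ge0// ltW.
pose E : set R := Ddom (n%:R * h).
pose psi (i : nat) (x : R) : R := x + (i%:R - n%:R / 2) * h * phi x.
(* Nodes may hit the endpoints, where [g'] and [g] are not assumed to agree. *)
pose N' : set R := N `|` ([set -1] `|` [set 1]).
have N'0 : mu N' = 0%E.
  apply: negligible_null; apply: negligibleU; first exact: null_negligible.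
  by apply: negligibleU; apply: null_negligible; exact: lebesgue_measure_set1.
pose B (i : nat) : set R := if (i <= n)%N then E `&` psi i @^-1` N' else set0.
exists (\bigcup_i B i); split.
  apply: negligible_null; apply: negligible_bigcup => i; rewrite /B.
  case: ifP => [i_n|_]; last exact: negligible_set0.
  apply: null_negligible; apply: (@measure_expanding_preimage0 R E _ 2^-1) => //.
  move=> u v uE vE; apply: (node_map_expanding nh0) => //.
  rewrite normrM (gtr0_norm h0) mulrAC ler_wpM2r ?(ltW h0)//.
  have : (i%:R <= n%:R :> R) by rewrite ler_nat.
  have : (0 <= i%:R :> R) by [].
  by move=> ? ?; rewrite ler_norml; apply/andP; split; lra.
move=> x xE xM; rewrite (sym_diff_Ddom g (ltW h0) xE) /Wweight /weighted_diff.
congr (_ * _); [by rewrite mulrA|rewrite /fwd_diff].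
have [_ xd] := (DdomP _ nh0).1 xE.
have := ler_norm x; have := ler_norm (- x); rewrite normrN => a1 a2.
have H0 : 0 <= h * phi x by rewrite mulr_ge0 ?phi_ge0// ltW.
apply: eq_bigr => i _; congr (_ * _).
have i_n : (i <= n)%N by rewrite -ltnS.
have -> : x - n%:R * (h * phi x) / 2 + i%:R * (h * phi x) = psi i x.
  by rewrite /psi; field.
have iH : 0 <= i%:R * (h * phi x) <= n%:R * (h * phi x).
  by rewrite mulr_ge0//= ler_wpM2r// ler_nat.
have xN : ~ N' (psi i x).
  by move=> xN; apply: xM; exists (nat_of_ord i) => //; rewrite /B i_n.
apply/esym/gg'; last by move=> ?; apply: xN; left.
rewrite !lt_neqAle -!andbA; apply/and4P; split.
- by apply/eqP => e; apply: xN; right; left; rewrite /= -e.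
- by case/andP: iH => ? ?; rewrite /psi; lra.
- by apply/eqP => e; apply: xN; right; right; rewrite /= -e.
- by case/andP: iH => ? ?; rewrite /psi; lra.
Qed.

End borel_modulus.

Lemma in_B_lebesgue_measurable (R : realType) (alpha beta : R) p r (f : R -> R) :
  in_B (jacobi alpha beta) p r f ->
  lebesgue_measurable_fun `]-1, 1[%classic (derive1n r f).
Proof.
have sub : `]-1, 1[%classic `<=` @I11 R.
  by move=> x /=; rewrite /I11 /= !in_itv /= => /andP[? ?]; rewrite !ltW.
case: r => [[mf _]|r [_ _ [mf _]]].
  by apply: (@measurable_funS _ _ (lebesgueR R) R (@I11 R)) => //;
    apply: borel_lebesgue_measurable; exact: measurable_itv.
have mI : measurable (`]-1, 1[%classic : set (lebesgueR R)).
  by apply: borel_lebesgue_measurable; exact: measurable_itv.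
have mI11 : measurable (@I11 R : set (lebesgueR R)).
  by apply: borel_lebesgue_measurable; exact: measurable_itv.
(* Membership gives measurability of the derivative only after multiplication by a power of phi,
   which is divided out on the open interval. *)
pose G (x : R) := (phi x `^ (-1)) ^+ r.+1 * (phi x ^+ r.+1 * derive1n r.+1 f x).
apply: (@eq_measurable_fun _ _ (lebesgueR R) R _ G).
  move=> x; rewrite inE /= in_itv /= => /andP[x1 x2].
  have px : 0 < phi x by apply: phi_gt0; rewrite ltr_norml x1.
  by rewrite /G powR_inv1 ?(ltW px)// mulrA -exprMn mulVf ?gt_eqF// expr1n mul1r.
apply: measurable_funM; last exact: (measurable_funS mI11 sub mf).
apply: measurable_fun_lebesgue; first exact: measurable_itv.
apply: measurable_funTS; apply: measurable_funX.
exact: (measurableT_comp (measurable_powR (-1)) (@measurable_phi R)).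
Qed.

Lemma ge0_le_poweR (R : realType) (s : R) (x y : \bar R) :
  0 <= s -> (0 <= x)%E -> (x <= y)%E -> (x `^ s <= y `^ s)%E.
Proof.
move=> s0 x0 xy; apply: gt0_ler_poweR => //; rewrite in_itv /= leey andbT//.
exact: le_trans xy.
Qed.

Lemma poweRVK (R : realType) (q : R) (x : \bar R) :
  q != 0 -> (0 <= x)%E -> ((x `^ q^-1) `^ q = x)%E.
Proof. by move=> q0 x0; rewrite -poweRrM mulVf// poweRe1. Qed.

Section modulus.
Variables (R : realType) (k r : nat) (alpha beta : R) (g : R -> R) (t : R).
Hypotheses (k0 : (0 < k)%N).
Hypotheses (halpha : 0 <= r%:R / 2 + alpha) (hbeta : 0 <= r%:R / 2 + beta).
Hypothesis mg : lebesgue_measurable_fun `]-1, 1[%classic g.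
Hypothesis t0 : 0 < t.
Notation mu := (@lebesgue_measure R).
Let xi : R := r%:R / 2 + alpha.
Let zeta : R := r%:R / 2 + beta.
Let K : R := node_const R k.
Let C : R := k%:R * #|{: node_index k}|%:R * 16.
Let K0 : 0 < K. Proof. exact: node_const_gt0. Qed.
Let C0 : 0 <= C. Proof. by rewrite !mulr_ge0. Qed.

Let W n (s x : R) : R := Wweight (n%:R * s) xi zeta x * sym_diff n (s * phi x) g x.

(** One [g'] serves all orders and steps; only the null set depends on them. *)
Let borel_representative : exists g' : R -> R, measurable_fun [set: R] g' /\
  forall n s, 0 < s -> exists2 M : set R, mu M = 0%E &
    forall x, Ddom (n%:R * s) x -> ~ M x ->
      W n s x = weighted_diff g' xi zeta n (n%:R * (s * phi x)) x (s * phi x).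
Proof.
have [g' [N [mg' N0 gg']]] := borel_version (measurable_itv _) mg.
exists g'; split => // n s s0.
have [|M [M0 HM]] := sym_diff_borel (g := g) (g' := g') xi zeta N0 _ n s0.
  by move=> x x1; apply: gg'; rewrite /= in_itv.
by exists M.
Qed.

Let Lp_norm_le_omega p s : 0 < s <= t ->
  (Lp_norm p (Ddom (k%:R * s)) (W k s) <= omega k r g t alpha beta p)%E.
Proof. by move=> st; apply: ereal_sup_ubound; exists s. Qed.

Let omega_ge0 p : (0 <= omega k r g t alpha beta p)%E.
Proof.
apply: le_trans (Lp_norm_le_omega p (s := t) _); last by rewrite t0 lexx.
by rewrite /Lp_norm; exact: Lnorm_ge0.
Qed.

Lemma omegaS_le_fin q : 1 <= q ->
  (omega k.+1 r g t alpha beta q%:E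
    <= (C `^ q^-1 * K)%:E * omega k r g t alpha beta q%:E)%E.
Proof.
move=> q1; have q0 : 0 < q by exact: lt_le_trans q1.
have [g' [mg' Hg']] := borel_representative.
apply: ge_ereal_sup => _ [h /= /andP[h0 ht] <-].
set S := omega k _ _ _ _ _ _.
(* The factor [K] undoes the division by [K] in [integral_weighted_diffS_le], and reappears as
   [K ^ q] in the bound [HS]. *)
pose v (z : R) := ((K * z) `^ q)%:E.
have mWD := measurable_weighted_diff_phi xi zeta mg'.
have nE n s : 0 < s -> (Lp_norm q%:E (Ddom (n%:R * s)) (W n s) =
    (\int[mu]_(x in Ddom (n%:R * s))
      (`|weighted_diff g' xi zeta n (n%:R * (s * phi x)) x (s * phi x)| `^ q)%:E)
    `^ q^-1)%E.
  move=> s0; have [M M0 HM] := Hg' n s s0.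
  apply: (Lp_norm_EFin _ _ M0 HM q0) => //.
  by apply: measurable_Ddom; rewrite mulr_ge0// ltW.
have v0 z : (0 <= v z)%E by rewrite lee_fin powR_ge0.
have mv : measurable_fun [set: R] v.
  apply/measurable_EFinP; apply: (measurableT_comp (measurable_powR q)).
  exact: measurable_funM.
have vmono z w : 0 <= z -> z <= w -> (v z <= v w)%E.
  move=> z0 zw; rewrite lee_fin; apply: ge0_ler_powR.
  - exact: ltW.
  - by rewrite nnegrE mulr_ge0// ltW.
  - by rewrite nnegrE; apply: mulr_ge0; [exact: ltW|exact: le_trans zw].
  - by rewrite ler_wpM2l// ltW.
have mN n s : measurable_fun [set: R] (fun x =>
    (`|weighted_diff g' xi zeta n (n%:R * (s * phi x)) x (s * phi x)| `^ q)%:E).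
  apply/measurable_EFinP; apply: (measurableT_comp (measurable_powR q)).
  by apply: measurableT_comp => //; exact: mWD.
have S0 : (0 <= S)%E := omega_ge0 _.
have q00 : q != 0 by rewrite gt_eqF.
have qV0 : (0 <= q^-1) by rewrite invr_ge0 ltW.
have HS (s : R) : 0 < s <= h -> (\int[mu]_(y in Ddom (k%:R * s))
    v `|weighted_diff g' xi zeta k (k%:R * (s * phi y)) y (s * phi y)|%R <=
    (K `^ q)%:E * S `^ q)%E.
  move=> /andP[s0 sh]; have mD : measurable (Ddom (k%:R * s) : set R).
    by apply: measurable_Ddom; rewrite mulr_ge0// ltW.
  under eq_integral => y _ do rewrite /v powRM ?(ltW K0)// EFinM.
  rewrite ge0_integralZl//; last 2 first.
  - exact: measurable_funTS (mN k s).
  - by rewrite lee_fin powR_ge0.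
  rewrite lee_wpmul2l ?lee_fin ?powR_ge0//.
  have := Lp_norm_le_omega q%:E (s := s).
  rewrite s0 (le_trans sh ht) nE// => /(_ isT).
  set J := (X in (X `^ _ <= _)%E) => HJ.
  have J0 : (0 <= J)%E.
    by apply: integral_ge0 => y _; rewrite lee_fin powR_ge0.
  have := ge0_le_poweR (ltW q0) (poweR_ge0 _ _) HJ.
  by rewrite (poweRVK q00 J0).
have := integral_weighted_diffS_le k0 mg' halpha hbeta mv v0 vmono h0 HS.
under eq_integral => x _ do rewrite /v mulrC divfK ?gt_eqF//.
rewrite nE//; set J := integral _ _ _ => HJ.
have J0 : (0 <= J)%E by apply: integral_ge0 => y _; rewrite lee_fin powR_ge0.
apply: le_trans (ge0_le_poweR qV0 J0 HJ) _.
clearbody S; rewrite !poweRM ?mule_ge0 ?poweR_ge0 ?lee_fin ?powR_ge0//.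
by rewrite -poweRrM !poweR_EFin -powRrM mulfV// powRr1 ?(ltW K0)// poweRe1// muleA.
Qed.

(** With [M] the modulus of order [k], the averaged bound holds with [S = 0]: the weighted
    difference of order [k + 1] exceeds [K M] only on a null set. *)
Lemma omegaS_le_infty :
  (omega k.+1 r g t alpha beta +oo
    <= K%:E * omega k r g t alpha beta +oo)%E.
Proof.
have [g' [mg' Hg']] := borel_representative.
apply: ge_ereal_sup => _ [h /= /andP[h0 ht] <-].
have := omega_ge0 +oo%E; have := fun s => Lp_norm_le_omega +oo%E (s := s).
(* An infinite modulus makes the bound trivial, and nonnegativity excludes [-oo]. *)
case: (omega k _ _ _ _ _ _) => [M| |] HM M0; last by [].
  2: by rewrite gt0_muley ?lte_fin// leey.
rewrite lee_fin in M0; rewrite -EFinM.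
pose v (z : R) : \bar R := (\1_(`]M, +oo[%classic : set R) z)%:E.
have mWD := measurable_weighted_diff_phi xi zeta mg'.
have mD n (s : R) : 0 < s -> measurable (Ddom (n%:R * s) : set R).
  by move=> s0; apply: measurable_Ddom; rewrite mulr_ge0// ltW.
have nE n (s a : R) : 0 < s -> 0 <= a ->
    (Lp_norm +oo (Ddom (n%:R * s)) (W n s) <= a%:E)%E <->
    mu (Ddom (n%:R * s) `&` [set x | a <
      `|weighted_diff g' xi zeta n (n%:R * (s * phi x)) x (s * phi x)|]) = 0%E.
  move=> s0 a0; have [N N0 HN] := Hg' n s s0.
  exact: (Lp_norm_infty_le N0 HN a0).
have v0 z : (0 <= v z)%E by rewrite lee_fin.
have mv : measurable_fun [set: R] v.
  by apply/measurable_EFinP; apply: measurable_indic; exact: measurable_itv.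
have vmono z w : 0 <= z -> z <= w -> (v z <= v w)%E.
  move=> _ zw; rewrite lee_fin /v !indicE !mem_setE !in_itv /= !andbT.
  by case: (ltP M z) => // /lt_le_trans -> //.
have vI n (s c : R) : 0 < s -> 0 < c -> (\int[mu]_(y in Ddom (n%:R * s))
    v (`|weighted_diff g' xi zeta n (n%:R * (s * phi y)) y (s * phi y)| / c)%R =
    mu (Ddom (n%:R * s) `&` [set x | (c * M <
      `|weighted_diff g' xi zeta n (n%:R * (s * phi x)) x (s * phi x)|)%R]))%E.
  move=> s0 c0.
  pose f x := weighted_diff g' xi zeta n (n%:R * (s * phi x)) x (s * phi x).
  pose A : set R := [set x | c * M < `|f x|].
  have mA : measurable A.
    have mf : measurable_fun [set: R] (fun x => `|f x|).
      by apply: measurableT_comp => //; exact: mWD.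
    rewrite (_ : A = setT `&` (fun x => `|f x|) @^-1` `]c * M, +oo[%classic).
      by apply: mf => //; exact: measurable_itv.
    by rewrite setTI; apply/seteqP; split => x; rewrite /A /= in_itv /= andbT.
  rewrite -[RHS]/(mu (_ `&` A)) setIC -integral_indic//; last exact: mD.
  apply: eq_integral => x _; rewrite /v !indicE; congr (_%:R%:E); congr nat_of_bool.
  by rewrite !mem_setE /= in_itv /= andbT ltr_pdivlMr// mulrC.
have HS (s : R) : 0 < s <= h -> (\int[mu]_(y in Ddom (k%:R * s))
    v `|weighted_diff g' xi zeta k (k%:R * (s * phi y)) y (s * phi y)|%R <= 0)%E.
  move=> /andP[s0 sh]; under eq_integral => y _ do rewrite -[`|_|%R]divr1.
  have L := HM s; rewrite s0 (le_trans sh ht) in L.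
  have E0 := (nE k s M s0 M0).1 (L isT).
  by rewrite vI// mul1r E0.
have := integral_weighted_diffS_le k0 mg' halpha hbeta mv v0 vmono h0 HS.
rewrite mule0 vI// => le0; apply/nE => //; first by rewrite mulr_ge0// ltW.
by apply/eqP; rewrite eq_le le0 measure_ge0.
Qed.

End modulus.

Unset Implicit Arguments.

Theorem lemma1p12 (R : realType) (k r : nat) (p : \bar R) (alpha beta : R)
    (hk : (0 < k)%N) (hp : (1 <= p)%E)
    (halpha : 0 <= r%:R / 2 + alpha) (hbeta : 0 <= r%:R / 2 + beta) :
  exists c : R, 0 < c /\
    forall f : R -> R, in_B (jacobi alpha beta) p r f ->
    forall t : R, 0 < t ->
      (omega k.+1 r (derive1n r f) t alpha beta p
         <= c%:E * omega k r (derive1n r f) t alpha beta p)%E.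
Proof.
case: p hp => [q| |] hp; last by [].
- exists ((k%:R * #|{: node_index k}|%:R * 16) `^ q^-1 * node_const R k); split.
    rewrite mulr_gt0 ?node_const_gt0// powR_gt0// !mulr_gt0 ?ltr0n//.
    (* The index type is nonempty because [k > 0]. *)
    by rewrite !card_prod !card_ord card_bool !muln_gt0 addnS hk.
  move=> f /in_B_lebesgue_measurable mf t t0.
  exact: omegaS_le_fin hk halpha hbeta mf t0 q hp.
- exists (node_const R k); split; first exact: node_const_gt0.
  move=> f /in_B_lebesgue_measurable mf t t0.
  exact: omegaS_le_infty hk halpha hbeta mf t0.
Qed.
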